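(* Fix $\beta,h$ with either $h>0$ and $\beta>0$, or $h=0$ and $0<\beta<1$. For each $n$, let $S=(S_1,\dots,S_n)\in\{-1,+1\}^n$ have the Curie–Weiss distribution $$\mathbb{P}\bigl(S=(s_1,\dots,s_n)\bigr)=Z_{\beta,h}^{-1}\exp\Bigl\{\frac{\beta}{n}\sum_{1\le i<j\le n}s_is_j+h\sum_{i=1}^ns_i\Bigr\},$$ let $W=W_n=\sum_{i=1}^nS_i$, $\sigma_n^2:=\mathrm{Var}(W)$, and $\widetilde W:=\bigl(W+\tfrac12\{1-(-1)^n\}\bigr)/2$. Then, as $n\to\infty$, $$d_{\mathrm{TV}}\Bigl(\mathcal{L}(\widetilde W),\mathrm{TP}\Bigl(\frac{nm_h}{2},\frac{n(1-m_h^2)}{4(1-\beta+\beta m_h^2)}\Bigr)\Bigr)=O(\sigma_n^{-1})=O(n^{-1/2}),$$ $$d_{\mathrm{loc}}\Bigl(\mathcal{L}(\widetilde W),\mathrm{TP}\Bigl(\frac{nm_h}{2},\frac{n(1-m_h^2)}{4(1-\beta+\beta m_h^2)}\Bigr)\Bigr)=O(\sigma_n^{-2})=O(n^{-1}).$$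
   Context: $Z_{\beta,h}$ is the normalizing constant. $m_h$ denotes: for $h>0$, the unique positive solution $m$ of $m=\tanh(\beta m+h)$; for $h=0$ and $0<\beta<1$, $m_0=0$ (the only solution). Translated Poisson distribution: $Z\sim\mathrm{TP}(\mu,\sigma^2)$ means that $Z-s$ has the Poisson distribution with mean $\sigma^2+\gamma$, where $s:=\lfloor\mu-\sigma^2\rfloor$ and $\gamma:=\mu-\sigma^2-\lfloor\mu-\sigma^2\rfloor$. Metrics for integer valued $X,Y$: $d_{\mathrm{TV}}(\mathcal{L}(X),\mathcal{L}(Y)):=\sup_{A\subseteq\mathbb{Z}}|\mathbb{P}[X\in A]-\mathbb{P}[Y\in A]|$ and $d_{\mathrm{loc}}(\mathcal{L}(X),\mathcal{L}(Y)):=\sup_{a\in\mathbb{Z}}|\mathbb{P}[X=a]-\mathbb{P}[Y=a]|$. *)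

(* Defs.v *)
From HB Require Import structures.
From mathcomp Require Import all_boot all_order all_algebra.
From mathcomp Require Import all_classical all_reals all_analysis.

Set Implicit Arguments.
Unset Strict Implicit.
Unset Printing Implicit Defensive.

Import Order.TTheory GRing.Theory Num.Theory.
Import numFieldNormedType.Exports.

Local Open Scope classical_set_scope.
Local Open Scope ring_scope.

Section CurieWeiss.
Context {R : realType}.

Definition tanh (x : R) : R :=
  (expR x - expR (- x)) / (expR x + expR (- x)).

(* For h > 0 (and beta > 0) the fixed-point equation has exactly one positive
   solution, so the choice made by xget is immaterial. *)
Definition mean_spin (beta h : R) : R :=
  if h == 0 then 0
  else xget 0 [set m : R | 0 < m /\ m = tanh (beta * m + h)].

Definition cw_weight (beta h : R) (n : nat) (s : 'I_n -> R) : R :=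
  expR (beta / n%:R * (\sum_(i < n) \sum_(j < n | (i < j)%N) s i * s j)
        + h * \sum_(i < n) s i).

(* The spin configurations are enumerated by boolean functions,
   false standing for +1 and true for -1. *)
Definition cw_Z (beta h : R) (n : nat) : R :=
  \sum_(b : {ffun 'I_n -> bool}) cw_weight beta h (fun i => (-1) ^+ b i).

Definition curie_weiss (beta h : R) (n : nat) d (T : measurableType d)
    (P : probability T R) (S : 'I_n -> {RV P >-> R}) : Prop :=
  (forall i w, S i w = -1 \/ S i w = 1) /\
  (forall s : 'I_n -> R, (forall i, s i = -1 \/ s i = 1) ->
     P [set w | forall i, S i w = s i]
       = ((cw_Z beta h n)^-1 * cw_weight beta h s)%:E).

(* Laws of integer valued random variables are represented as measures on R,
   which are only evaluated on images of subsets of int. *)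
Definition dTV (mu nu : set R -> \bar R) : R :=
  sup [set `|fine (mu (intr @` A)) - fine (nu (intr @` A))|
      | A in [set: set int]].

Definition dloc (mu nu : set R -> \bar R) : R :=
  sup [set `|fine (mu [set a%:~R]) - fine (nu [set a%:~R])|
      | a in [set: int]].

(* The second argument of poisson_prob is a dummy: poisson_prob r k is the
   Poisson measure of mean r whatever k is. *)
Definition translated_poisson (mu sigma2 : R) : set R -> \bar R :=
  let s := Num.floor (mu - sigma2) in
  let gamma := mu - sigma2 - s%:~R in
  pushforward (poisson_prob (sigma2 + gamma) 0%N)
    (fun k : nat => s%:~R + k%:R : R).

End CurieWeiss.

(* Main.v *)
Require Import Defs.
From HB Require Import structures.
From mathcomp Require Import all_boot all_order all_algebra.
From mathcomp Require Import all_classical all_reals all_analysis.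
From mathcomp Require Import zify ring lra.

(* Let W = 2j - n, so that j counts the +1 spins. Both the law of j and the
   Poisson law satisfy a local relation
     ln p(i+1) - ln p(i) = - kappa (i - i0) / n + O(1/n + ((i - i0)/n)^2)
   around their centre i0, with the same kappa = 4 (1/(1-m^2) - beta), i.e.
   n/kappa is the variance parameter of the translated Poisson law. Summing
   this relation shows that on a window |i - i0| <= delta n each law, divided
   by its value at i0, is within O(n^(-1/2)) exp(-2 |i - i0| / sqrt n) of the
   Gaussian profile exp(-kappa (i - i0)^2 / (2n)); since both laws put all but
   O(1/n) of their mass on the window, the normalisations agree too, and the two
   laws differ by O(1/n) exp(-2 |i - i0| / sqrt n) pointwise. This gives the
   local bound at once and, after summation, the total variation bound. Outside
   the window the Curie-Weiss law is small because the drift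
   2 (beta y + h) - ln ((1+y)/(1-y)) pushes y = W/n towards m on [0, 1) (by
   convexity), and because the weight of -W is exp(-2hW) times the one of W; the
   Poisson law is handled by Chernoff's bound. *)

Import Order.TTheory GRing.Theory Num.Theory.
Import numFieldNormedType.Exports.

Local Open Scope classical_set_scope.
Local Open Scope ring_scope.

(** * Real bounds *)

Section Real_bounds.
Context {R : realType}.
Implicit Types (x y c k : R).

(** Neither law is normalised by Stirling's formula or by an integral. Both are compared with the
    same discrete Gaussian divided by its own sum over the window. This takes only the ratio
    relation, a total mass [1 + O(n^(-1/2))] on the window, and a lower bound of order [sqrt n] for
    the Gaussian sum. The relation is asked only up to [O(1/n)], so the centres may be rounded to
    integers. The Poisson centre is chosen as the image of the Curie-Weiss centre, so that the two
    Gaussian terms cancel index by index. The factor [exp(-2 |i - i0| / sqrt n)] is essential: a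
    uniform [O(1/n)] error would sum to [O(1)] over a window of order [n]. It is taken out of the
    Gaussian itself. Summing the quadratic errors puts a cubic term in the exponent, and [delta] is
    so small that this term uses up at most half of the Gaussian exponent. Since the rates are
    stated through [sigma_n], the variance must also be bounded above and below by multiples of
    [n]. *)

Lemma expR_dist x y c : x <= c -> y <= c ->
  `|expR x - expR y| <= `|x - y| * expR c.
Proof.
wlog xy : x y / x <= y.
  move=> H xc yc; case: (leP x y) => [|/ltW] xy; first exact: H.
  by rewrite distrC (distrC x); exact: H.
move=> xc yc; rewrite distrC (distrC x) !ger0_norm ?subr_ge0 ?ler_expR//.
have -> : expR y - expR x = (1 - expR (x - y)) * expR y.
  by rewrite mulrBl mul1r -expRD subrK.
apply: ler_pM; rewrite ?expR_ge0 ?ler_expR ?subr_ge0 ?expR_le1 ?subr_le0//.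
by have := expR_ge1Dx (x - y); lra.
Qed.

Lemma expr_le_expR x (n : nat) : 0 <= x -> x ^+ n.+1 <= n.+1%:R ^+ n.+1 * expR x.
Proof.
move=> x0; have -> : expR x = expR (x / n.+1%:R) ^+ n.+1.
  by rewrite -expRM_natl mulrC divfK.
rewrite -exprMn; apply: lerXn2r.
- by rewrite nnegrE.
- by rewrite nnegrE mulr_ge0 ?expR_ge0.
have : x / n.+1%:R <= expR (x / n.+1%:R).
  by apply: le_trans (expR_ge1Dx _); rewrite lerDr.
by rewrite ler_pdivrMr ?ltr0n// mulrC.
Qed.

(** [x + x ^+ 3] is at most [(1 + 3 ^+ 3) * expR x], and [9 / (4 * k)] is the maximum of
    [3 * x - k * x ^+ 2]. *)
Lemma cubic_gauss_bound k : 0 < k -> exists2 K : R, 0 <= K &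
  forall x, 0 <= x -> (x + x ^+ 3) * expR (- (k * x ^+ 2)) <= K * expR (- (2 * x)).
Proof.
move=> k0; exists (28 * expR (9 / (4 * k))); first by rewrite mulr_ge0 ?expR_ge0.
move=> x x0.
have h1 : x + x ^+ 3 <= 28 * expR x.
  have := expr_le_expR x 2 x0; have := expr_le_expR x 0 x0.
  rewrite !expr1 mul1r => a b.
  have -> : 28 * expR x = expR x + 3 ^+ 3 * expR x by ring.
  exact: lerD.
apply: (@le_trans _ _ (28 * expR x * expR (- (k * x ^+ 2)))).
  by rewrite ler_wpM2r ?expR_ge0.
rewrite -!mulrA -!expRD ler_wpM2l// ler_expR.
have -> : 9 / (4 * k) + - (2 * x) = x + - (k * x ^+ 2) + k * (x - 3 / (2 * k)) ^+ 2.
  by field; rewrite gt_eqF.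
by rewrite lerDl mulr_ge0 ?sqr_ge0// ltW.
Qed.

(** Converts exponential tail bounds into [K / n ^+ 2], a size that still gives [O(1/n)] after
    summation over [n + 1] points. *)
Lemma expRN_le_inv_sqr c : 0 < c -> exists2 K : R, 0 <= K &
  forall x, 0 < x -> expR (- (c * x)) <= K / x ^+ 2.
Proof.
move=> c0; exists (4 / c ^+ 2); first by rewrite divr_ge0 ?sqr_ge0.
move=> x x0; have cx0 : 0 < c * x by rewrite mulr_gt0.
have := expr_le_expR (c * x) 1 (ltW cx0).
rewrite expRN -ler_pdivrMl; last by rewrite exprn_gt0.
move=> h.
rewrite -invf_div lef_pV2 ?posrE ?expR_gt0 ?divr_gt0 ?exprn_gt0 ?divr_gt0//.
apply: le_trans h; rewrite le_eqVlt; apply/orP; left; apply/eqP.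
by field; rewrite !gt_eqF.
Qed.

(** Geometric series of ratio [q = expR (- (c / x))]: the bound [(1 - q)^-1 <= 1 + x / c] amounts to
    [q * (1 + c / x) <= 1]. *)
Lemma sum_expRN_le c x (n : nat) : 0 < c -> 0 < x ->
  \sum_(0 <= t < n) expR (- (c * (t%:R / x))) <= 1 + x / c.
Proof.
move=> c0 x0; set q := expR (- (c / x)).
have cx : 0 < c / x by rewrite divr_gt0.
have q1 : q < 1 by rewrite expR_lt1; lra.
have q0 : 0 < q by rewrite expR_gt0.
have -> : \sum_(0 <= t < n) expR (- (c * (t%:R / x))) = (1 - q ^+ n) / (1 - q).
  under eq_bigr => t _.
    have -> : - (c * (t%:R / x)) = t%:R * - (c / x) by field; rewrite gt_eqF.
    rewrite expRM_natl -/q; over.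
  have qn1 : q != 1 by rewrite lt_eqF.
  have := geometric_seriesE 1 qn1.
  move=> /(congr1 (fun f => f n)); rewrite /series/=/geometric/= mul1r => <-.
  by apply: eq_bigr => i _; rewrite mul1r.
rewrite ler_pdivrMr ?subr_gt0//.
apply: (@le_trans _ _ 1); first by have := exprn_gt0 n q0; lra.
have : q * (1 + c / x) <= 1.
  rewrite /q expRN mulrC ler_pdivrMr ?expR_gt0// mul1r; exact: expR_ge1Dx.
move=> h; rewrite -(ler_pM2r cx).
have -> : (1 + x / c) * (1 - q) * (c / x) = (c / x + 1) - q * (1 + c / x).
  by field; rewrite !gt_eqF.
lra.
Qed.

End Real_bounds.

(** * Local limits from ratio asymptotics *)

Section Local_limit.
Context {R : realType}.
Implicit Types (kappa C r : R).

(** One side of the centre: [t] is the distance to it and [a] the law divided by its central value.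
    With [x = t / r], summing the increments makes [ln (a t)] equal to [- kappa / 2 * x ^+ 2] up to
    [C1 * (x + x ^+ 3) / r]; half of the Gaussian then absorbs the cubic term and the other half
    supplies the decay. *)
Lemma gaussian_profile kappa C : 0 < kappa -> 0 <= C ->
  exists delta K : R, [/\ 0 < delta, 0 <= K &
  forall r (M : nat) (a : nat -> R), 1 <= r -> M%:R <= delta * r ^+ 2 ->
  (forall t, (t <= M)%N -> 0 < a t) -> a 0%N = 1 ->
  (forall t, (t < M)%N -> `|ln (a t.+1) - ln (a t) + kappa * t%:R / r ^+ 2|
     <= C * ((r ^+ 2)^-1 + (t%:R / r ^+ 2) ^+ 2)) ->
  forall t, (t <= M)%N ->
    `|a t - expR (- (kappa / 2 * (t%:R / r) ^+ 2))|
      <= K / r * expR (- (2 * (t%:R / r)))].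
Proof.
(* The added [kappa] pays for [t ^+ 2 / 2] in place of [t * (t - 1) / 2], the true sum of the
   indices below [t]. *)
move=> k0 C0; set C1 := C + kappa.
have C10 : 0 < C1 by rewrite /C1; lra.
have [K K0 HK] : exists2 K : R, 0 <= K & forall x : R, 0 <= x ->
    (x + x ^+ 3) * expR (- (kappa / 4 * x ^+ 2)) <= K * expR (- (2 * x)).
  by apply: cubic_gauss_bound; lra.
(* Since [x / r = t / r ^+ 2 <= delta], the bound 1 keeps the linear error below [C1], and
   [kappa / (4 * C1)] keeps the cubic one below [kappa / 4 * x ^+ 2]. *)
exists (Num.min 1 (kappa / (4 * C1))), (C1 * K * expR C1).
have d0 : 0 < Num.min 1 (kappa / (4 * C1)) by rewrite lt_min ltr01 divr_gt0 ?mulr_gt0.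
split => //; first by rewrite !mulr_ge0 ?expR_ge0// ltW.
move=> r M a r1 hM apos a0 ha t tM.
have r0 : 0 < r by lra.
have rn0 : r != 0 by rewrite gt_eqF.
have r20 : 0 < r ^+ 2 by rewrite exprn_gt0.
have lnat : `|ln (a t) + kappa / 2 * (t%:R / r) ^+ 2|
    <= C1 * (t%:R / r + (t%:R / r) ^+ 3) / r.
  elim: t tM => [|t IH] tM.
    by rewrite a0 ln1 mul0r !expr0n/= !mulr0 !addr0 normr0 mulr0 mul0r.
  have {IH} := IH (ltnW tM); have := ha t tM.
  rewrite -(natr1 t); set s : R := t%:R; have s0 : 0 <= s by [].
  set u := ln (a t.+1); set v := ln (a t) => h1 h2.
  have -> : u + kappa / 2 * ((s + 1) / r) ^+ 2 =
      (u - v + kappa * s / r ^+ 2) + (v + kappa / 2 * (s / r) ^+ 2)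
        + kappa / 2 / r ^+ 2 by field.
  apply: (le_trans (ler_normD _ _)); rewrite [X in _ + X]ger0_norm; last first.
    by rewrite !divr_ge0 ?ltW.
  apply: (@le_trans _ _ (C * ((r ^+ 2)^-1 + (s / r ^+ 2) ^+ 2)
      + C1 * (s / r + (s / r) ^+ 3) / r + kappa / 2 / r ^+ 2)).
    rewrite lerD2r; apply: (le_trans (ler_normD _ _)); exact: lerD.
  have -> : C1 * ((s + 1) / r + ((s + 1) / r) ^+ 3) / r =
      C1 * (s / r + (s / r) ^+ 3) / r +
      C1 * ((r ^+ 2)^-1 + (s / r ^+ 2) ^+ 2 + (2 * s ^+ 2 + 3 * s + 1) / r ^+ 4).
    by field.
  set X := C1 * (s / r + (s / r) ^+ 3) / r.
  set A := (r ^+ 2)^-1; set B := (s / r ^+ 2) ^+ 2.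
  set D := (2 * s ^+ 2 + 3 * s + 1) / r ^+ 4.
  have A0 : 0 <= A by rewrite invr_ge0 ltW.
  have B0 : 0 <= B by rewrite sqr_ge0.
  have D0 : 0 <= D by rewrite divr_ge0 ?exprn_ge0 ?ltW//; nra.
  have : 0 <= kappa * A by rewrite mulr_ge0 // ltW.
  have : 0 <= kappa * B by rewrite mulr_ge0 // ltW.
  have : 0 <= (C + kappa) * D by rewrite mulr_ge0 // ltW.
  by clearbody X A B D; rewrite /C1; lra.
set x := t%:R / r in lnat *; set s : R := t%:R.
have x0 : 0 <= x by rewrite divr_ge0 // ltW.
have hs : s <= Num.min 1 (kappa / (4 * C1)) * r ^+ 2.
  by apply: le_trans hM; rewrite ler_nat.
have hs1 : x / r <= 1.
  rewrite /x -mulrA -invfM -expr2 ler_pdivrMr// mul1r.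
  apply: le_trans hs _; rewrite ger_pMl//; by rewrite ge_min lexx.
have hs2 : C1 * (x / r) <= kappa / 4.
  have : x / r <= kappa / (4 * C1).
    rewrite /x -mulrA -invfM -expr2 ler_pdivrMr//.
    apply: le_trans hs _; rewrite ler_pM2r//; by rewrite ge_min lexx orbT.
  rewrite !ler_pdivlMr//; last by rewrite mulr_gt0.
  lra.
have err : C1 * (x + x ^+ 3) / r <= C1 - - (kappa / 4 * x ^+ 2).
  have -> : C1 * (x + x ^+ 3) / r = C1 * (x / r) + C1 * (x / r) * x ^+ 2 by field.
  have := ler_wpM2r (sqr_ge0 x) hs2; have := ler_wpM2l (ltW C10) hs1; lra.
rewrite -{1}(lnK (apos t tM)).
have kx0 : 0 <= kappa * x ^+ 2 by rewrite mulr_ge0 ?sqr_ge0 ?ltW.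
(* Both exponents lie below [C1 - kappa / 4 * x ^+ 2], so the Lipschitz bound for [expR] keeps half
   of the Gaussian decay. *)
have := @expR_dist R (ln (a t)) (- (kappa / 2 * x ^+ 2)) (C1 - kappa / 4 * x ^+ 2).
rewrite opprK => /(_ _ _)/le_trans; apply.
- by move: lnat; rewrite ler_norml => /andP[_]; lra.
- by lra.
rewrite expRD.
apply: (@le_trans _ _ (C1 * (x + x ^+ 3) / r * (expR C1 * expR (- (kappa / 4 * x ^+ 2))))).
  by rewrite ler_wpM2r ?mulr_ge0 ?expR_ge0.
have := HK x x0.
set E := expR (- (kappa / 4 * x ^+ 2)) => HKx.
have -> : C1 * (x + x ^+ 3) / r * (expR C1 * E) =
  (C1 * expR C1 / r) * ((x + x ^+ 3) * E) by ring.
have -> : C1 * K * expR C1 / r * expR (- (2 * x)) =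
  (C1 * expR C1 / r) * (K * expR (- (2 * x))) by ring.
by apply: ler_wpM2l HKx; rewrite !mulr_ge0 ?expR_ge0 ?invr_ge0 ?ltW.
Qed.

End Local_limit.

(** * Local limit on a two-sided window, normalisation included *)

Section Window.
Context {R : realType}.
Implicit Types (kappa C r c : R).

Lemma sum_centered (F : nat -> R) (M : nat) :
  \sum_(0 <= u < M.*2.+1) F u =
  \sum_(0 <= t < M) F (M - t.+1)%N + \sum_(0 <= t < M.+1) F (M + t)%N.
Proof.
rewrite (@big_cat_nat _ _ _ M)//=; last by rewrite -addnn -addnS leq_addr.
congr +%R; first by rewrite big_nat_rev/=.
rewrite -{1}(add0n M) big_addn.
have -> : (M.*2.+1 - M = M.+1)%N by rewrite -addnn -addnS addKn.
by apply: eq_bigr => t _; rewrite addnC.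
Qed.

Lemma centeredP (Q : nat -> Prop) (M : nat) :
  (forall t, (t <= M)%N -> Q (M + t)%N) -> (forall t, (t <= M)%N -> Q (M - t)%N) ->
  forall u, (u < M.*2.+1)%N -> Q u.
Proof.
move=> Qr Ql u; rewrite ltnS => uM; case: (leqP M u) => Mu.
  by rewrite -(subnKC Mu); apply: Qr; rewrite leq_subLR addnn.
by rewrite -(subKn (ltnW Mu)); apply: Ql; rewrite leq_subr.
Qed.

(* Windows of radius [M] are indexed by [u] in [0, 2M] with centre [u = M]; [r] stands
   for the square root of the system size. *)
Definition gauss kappa r (M u : nat) : R :=
  expR (- (kappa / 2 * ((u%:R - M%:R) / r) ^+ 2)).

Definition gauss_mass kappa r (M : nat) : R :=
  \sum_(0 <= u < M.*2.+1) gauss kappa r M u.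

Definition decay c r (M u : nat) : R := expR (- (c * (`|u%:R - M%:R| / r))).

Lemma centerDE (M t : nat) : (M + t)%:R - M%:R = t%:R :> R.
Proof. by rewrite natrD addrAC subrr add0r. Qed.

Lemma centerBE (M t : nat) : (t <= M)%N -> (M - t)%:R - M%:R = - t%:R :> R.
Proof. by move=> tM; rewrite natrB// addrAC subrr add0r. Qed.

Lemma sum_decay_le c r (M : nat) : 0 < c -> 0 < r ->
  \sum_(0 <= u < M.*2.+1) decay c r M u <= 2 * (1 + r / c).
Proof.
move=> c0 r0; rewrite sum_centered mulr_natl mulr2n; apply: lerD.
  apply: le_trans (sum_expRN_le c r M c0 r0).
  apply: ler_sum_nat => t /andP[_ tM].
  rewrite /decay centerBE// normrN ger0_norm// ler_expR lerN2 ler_pM2l// ler_pM2r ?invr_gt0//.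
  by rewrite ler_nat.
apply: le_trans (sum_expRN_le c r M.+1 c0 r0).
apply: ler_sum_nat => t _.
by rewrite /decay centerDE ger0_norm.
Qed.

(** The points at distance at most [r] to the right of the centre suffice: there are
    [Num.truncn r + 1] of them, all in the window because [r <= M], and each term is at least
    [expR (- (kappa / 2))]. *)
Lemma gauss_mass_ge kappa r (M : nat) : 0 <= kappa -> 1 <= r <= M%:R ->
  expR (- (kappa / 2)) * r <= gauss_mass kappa r M.
Proof.
move=> k0 /andP[r1 rM]; have r0 : 0 < r by lra.
rewrite /gauss_mass sum_centered.
have nM : (Num.truncn r <= M)%N by rewrite -(ler_nat R) (le_trans _ rM)// truncn_le ltW.
apply: (@le_trans _ _ (\sum_(0 <= t < M.+1) gauss kappa r M (M + t)%N)); last first.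
  by rewrite lerDr sumr_ge0// => t _; exact: expR_ge0.
rewrite (@big_cat_nat _ _ _ (Num.truncn r).+1)//=.
apply: (@le_trans _ _ (\sum_(0 <= t < (Num.truncn r).+1) gauss kappa r M (M + t)%N)); last first.
  by rewrite lerDl sumr_ge0// => t _; exact: expR_ge0.
apply: (@le_trans _ _ (\sum_(0 <= t < (Num.truncn r).+1) expR (- (kappa / 2)))).
  rewrite sumr_const_nat subn0 -[leRHS]mulr_natr ler_wpM2l ?expR_ge0//.
  by have /andP[_ /ltW] := truncn_itv (ltW r0).
apply: ler_sum_nat => t /andP[_]; rewrite ltnS => tr.
rewrite /gauss centerDE ler_expR lerN2 ler_piMr ?divr_ge0// exprn_ile1 ?divr_ge0 ?(ltW r0)//.
rewrite ler_pdivrMr// mul1r; apply: (@le_trans _ _ (Num.truncn r)%:R).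
  by rewrite ler_nat.
by rewrite truncn_le ltW.
Qed.

Lemma gauss_le_decay kappa : 0 < kappa ->
  exists2 K : R, 0 <= K & forall r (M u : nat), gauss kappa r M u <= K * decay 2 r M u.
Proof.
move=> k0; exists (expR (2 / kappa)); first exact: expR_ge0.
move=> r M u; rewrite /gauss /decay -expRD ler_expR.
set y := _ - _; have -> : (y / r) ^+ 2 = (`|y| / r) ^+ 2.
  by rewrite !exprMn real_normK// num_real.
set x := _ / r.
have -> : 2 / kappa + - (2 * x) =
  - (kappa / 2 * x ^+ 2) + kappa / 2 * (x - 2 / kappa) ^+ 2 by field; rewrite gt_eqF.
by rewrite lerDl mulr_ge0 ?sqr_ge0// divr_ge0// ltW.
Qed.

(** Let [F] and [G] be the masses of [p] and of the Gaussian on the window. Summing the profile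
    estimate gives [F / p M - G = O(1)]. As [F = 1 + O(1 / r)] and [G] is at least of order [r], it
    follows that [p M = O(1 / r)] and [p M - G^-1 = O(1 / r ^+ 2)]. The conclusion is then read off
    from [p u - g / G = p M * (p u / p M - g) + g * (p M - G^-1)]. *)
Lemma local_limit kappa C : 0 < kappa -> 0 <= C ->
  exists delta K : R, [/\ 0 < delta, 0 <= K &
  forall r (M : nat) (p : nat -> R), 1 <= r <= M%:R -> M%:R <= delta * r ^+ 2 ->
  (forall u, (u < M.*2.+1)%N -> 0 < p u) ->
  (forall u, (u < M.*2)%N ->
     `|ln (p u.+1) - ln (p u) + kappa * (u%:R - M%:R) / r ^+ 2|
       <= C * ((r ^+ 2)^-1 + ((u%:R - M%:R) / r ^+ 2) ^+ 2)) ->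
  `|1 - \sum_(0 <= u < M.*2.+1) p u| <= C / r ->
  forall u, (u < M.*2.+1)%N ->
    `|p u - gauss kappa r M u / gauss_mass kappa r M|
      <= K / r ^+ 2 * decay 2 r M u].
Proof.
move=> k0 C0.
(* To the left of the centre the relation is read backwards, at distance [s + 1] instead of [s];
   this shift is what enlarges [C]. *)
have C'0 : 0 <= 3 * C + 2 * kappa by rewrite addr_ge0 ?mulr_ge0// ltW.
have [delta [K1 [d0 K10 prof]]] := gaussian_profile kappa (3 * C + 2 * kappa) k0 C'0.
have [K2 K20 gd] := gauss_le_decay kappa k0.
pose c := expR (- (kappa / 2)); have c0 : 0 < c by exact: expR_gt0.
(* [K3] will bound the distance between [F / p M] and [G], and [K4 / r] will bound [p M]. *)
pose K3 := K1 * 3; have K30 : 0 <= K3 by rewrite mulr_ge0.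
pose K4 := (1 + C) * (1 + K3) / c.
have K40 : 0 <= K4 by rewrite !mulr_ge0 ?invr_ge0 ?addr_ge0// ltW.
exists delta, (K4 * K1 + K2 * ((C + K4 * K3) / c)); split => //.
  apply: addr_ge0; first exact: mulr_ge0.
  apply: mulr_ge0 => //; apply: divr_ge0; last exact: ltW.
  by apply: addr_ge0 => //; exact: mulr_ge0.
move=> r M p rM Mr p0 hp S1; have /andP[r1 _] := rM.
have r0 : 0 < r by lra.
have r20 : 0 < r ^+ 2 by rewrite exprn_gt0.
have M2 : (M < M.*2.+1)%N by rewrite ltnS -addnn leq_addr.
have pM0 : 0 < p M by exact: p0.
have rel u : (u < M.*2.+1)%N ->
    `|p u / p M - gauss kappa r M u| <= K1 / r * decay 2 r M u.
  move: u; apply: centeredP => t tM.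
    pose a t := p (M + t)%N / p M.
    rewrite /gauss /decay centerDE (@ger0_norm _ t%:R)//.
    apply: (prof r M a) => //.
    - move=> s sM; rewrite divr_gt0// p0// ltnS -addnn leq_add2l//.
    - by rewrite /a addn0 divff// gt_eqF.
    move=> s sM; rewrite /a !ln_div ?posrE// ?p0//; last 2 first.
      by rewrite ltnS -addnn leq_add2l ltnW.
      by rewrite ltnS -addnn leq_add2l.
    have := hp (M + s)%N; rewrite centerDE addnS -addnn ltn_add2l => /(_ sM).
    set X := ln _; set Y := ln _; set Z := ln _ => h.
    have -> : X - Z - (Y - Z) = X - Y by ring.
    apply: (le_trans h); rewrite ler_wpM2r//; last by lra.
    by rewrite addr_ge0 ?invr_ge0 ?sqr_ge0.
  pose a t := p (M - t)%N / p M.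
  rewrite /gauss /decay centerBE// normrN (@ger0_norm _ t%:R)// mulNr sqrrN.
  apply: (prof r M a) => //.
  - move=> s sM; rewrite divr_gt0// p0// ltnS (leq_trans (leq_subr _ _))// -addnn leq_addr//.
  - by rewrite /a subn0 divff// gt_eqF.
  move=> s sM.
  have lt1 : (M - s.+1 < M.*2)%N.
    by rewrite (@leq_trans M)// ?rev_ord_proof// -?addnn ?leq_addr//
      -subSn// subSS leq_subr.
  rewrite /a !ln_div ?posrE// ?p0//; last 2 first.
    by rewrite ltnS (leq_trans (leq_subr _ _))// -addnn leq_addr.
    exact: ltnW.
  have := hp (M - s.+1)%N lt1; rewrite centerBE// -subSn// subSS.
  set X := ln _; set Y := ln _; set Z := ln _; rewrite -(natr1 s).
  set x : R := s%:R; have x0 : 0 <= x by [].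
  move=> h; have -> : Y - Z - (X - Z) + kappa * x / r ^+ 2 =
    - (X - Y + kappa * - (x + 1) / r ^+ 2) - kappa / r ^+ 2.
    by field; rewrite gt_eqF.
  apply: (le_trans (ler_normB _ _)); rewrite normrN [X in _ + X]ger0_norm; last first.
    by rewrite divr_ge0 ?ltW.
  have : `|X - Y + kappa * - (x + 1) / r ^+ 2| + kappa / r ^+ 2 <=
    C * ((r ^+ 2)^-1 + (- (x + 1) / r ^+ 2) ^+ 2) + kappa / r ^+ 2 by rewrite lerD2r.
  move=> /le_trans; apply.
  have -> : (- (x + 1) / r ^+ 2) ^+ 2 = (x / r ^+ 2) ^+ 2 + (2 * x + 1) / r ^+ 4.
    by field; rewrite gt_eqF.
  have h1 : (2 * x + 1) / r ^+ 4 <= (x / r ^+ 2) ^+ 2 + 2 / r ^+ 2.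
    have -> : (x / r ^+ 2) ^+ 2 + 2 / r ^+ 2 = (x ^+ 2 + 2 * r ^+ 2) / r ^+ 4.
      by field; rewrite gt_eqF.
    rewrite ler_pM2r ?invr_gt0 ?exprn_gt0//.
    have : 1 <= r ^+ 2 by rewrite exprn_ege1.
    have := sqr_ge0 (x - 1); nra.
  move: h1; rewrite [2 / _]mulrC (mulrC kappa).
  set A := (r ^+ 2)^-1; set B := (x / r ^+ 2) ^+ 2; set D := _ / r ^+ 4 => h1.
  have A0 : 0 <= A by rewrite invr_ge0 ltW.
  have B0 : 0 <= B by rewrite sqr_ge0.
  have := ler_wpM2l C0 h1.
  have : 0 <= kappa * A by rewrite mulr_ge0 // ltW.
  have : 0 <= kappa * B by rewrite mulr_ge0 // ltW.
  have : 0 <= C * B by rewrite mulr_ge0.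
  clearbody A B D; nra.
set F := \sum_(0 <= u < M.*2.+1) p u in S1.
set G := gauss_mass kappa r M.
have Gge : c * r <= G by apply: gauss_mass_ge => //; rewrite ltW.
have G0 : 0 < G by rewrite (lt_le_trans _ Gge)// mulr_gt0.
have FG : `|F / p M - G| <= K3.
  rewrite /F /G /gauss_mass big_distrl/= -sumrB.
  apply: (le_trans (ler_norm_sum _ _ _)).
  apply: (@le_trans _ _ (\sum_(0 <= u < M.*2.+1) K1 / r * decay 2 r M u)).
    by apply: ler_sum_nat => u /andP[_]; exact: rel.
  rewrite -big_distrr/=.
  have K1r : 0 <= K1 / r by rewrite divr_ge0// ltW.
  have := ler_wpM2l K1r (sum_decay_le 2 r M (ltr0Sn R 1) r0).
  move=> /le_trans; apply; rewrite -subr_ge0.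
  have -> : K3 - K1 / r * (2 * (1 + r / 2)) = K1 * (2 * (r - 1) / r).
    by rewrite /K3; field; rewrite gt_eqF.
  by rewrite mulr_ge0// divr_ge0 ?mulr_ge0 ?subr_ge0 ?(ltW r0).
have Cr : C / r <= C by rewrite ler_pdivrMr// ler_peMr.
have FpM : p M <= F.
  rewrite /F (bigD1_seq M) ?mem_index_iota ?iota_uniq//=.
  rewrite lerDl big_seq_cond sumr_ge0// => u.
  by rewrite mem_index_iota => /andP[/andP[_ uM] _]; rewrite ltW// p0.
have F1 : F <= 1 + C by move: S1; rewrite ler_norml => /andP[? ?]; lra.
have F0 : 0 < F by exact: lt_le_trans FpM.
have pG : `|p M * G - 1| <= C / r + p M * K3.
  have -> : p M * G - 1 = - (1 - F) - p M * (F / p M - G) by field; rewrite gt_eqF.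
  apply: (le_trans (ler_normB _ _)); rewrite normrN normrM (gtr0_norm pM0).
  by apply: lerD => //; rewrite ler_pM2l.
have pM1 : p M <= K4 / r.
  have : p M * G <= (1 + C) * (1 + K3).
    have : p M * K3 <= (1 + C) * K3 by rewrite ler_wpM2r//; lra.
    by move: pG; rewrite ler_norml => /andP[? ?]; lra.
  have : p M * (c * r) <= p M * G by rewrite ler_pM2l.
  move=> a b; have := le_trans a b; rewrite ler_pdivlMr// ler_pdivlMr//; lra.
have pinv : `|p M - G^-1| <= (C + K4 * K3) / c / r ^+ 2.
  have -> : p M - G^-1 = (p M * G - 1) / G by field; rewrite gt_eqF.
  rewrite normrM normfV (gtr0_norm G0) ler_pdivrMr//.
  apply: (le_trans pG); apply: (@le_trans _ _ ((C + K4 * K3) / r)).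
    by have := ler_wpM2r K30 pM1; rewrite mulrDl; lra.
  have -> : (C + K4 * K3) / r = (C + K4 * K3) / c / r ^+ 2 * (c * r) by field; rewrite !gt_eqF.
  apply: ler_wpM2l; last exact: Gge.
  apply: divr_ge0; last exact: ltW.
  by apply: divr_ge0; [exact: (addr_ge0 C0 (mulr_ge0 K40 K30))|exact: (ltW c0)].
move=> u uM; set g := gauss _ _ _ _; set e := decay _ _ _ _.
have e0 : 0 <= e by exact: expR_ge0.
have g0 : 0 <= g by exact: expR_ge0.
have -> : p u - g / G = p M * (p u / p M - g) + g * (p M - G^-1) by field; rewrite !gt_eqF.
apply: (le_trans (ler_normD _ _)); rewrite !normrM (gtr0_norm pM0) (ger0_norm g0).
have -> : (K4 * K1 + K2 * ((C + K4 * K3) / c)) / r ^+ 2 * e =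
  K4 / r * (K1 / r * e) + K2 * e * ((C + K4 * K3) / c / r ^+ 2) by field; rewrite !gt_eqF.
by apply: lerD; apply: ler_pM => //; [exact: ltW | exact: rel | exact: gd].
Qed.

End Window.

(** * The inverse hyperbolic tangent *)

Section Artanh.
Context {R : realType}.
Implicit Types (x y z m : R).

(** Twice the inverse hyperbolic tangent. For the [y] of [cw_pmf_ratio] below, [- artanh2 y] is the
    logarithm of the ratio of consecutive binomial coefficients. *)
Definition artanh2 y : R := ln (1 + y) - ln (1 - y).

Lemma is_derive_artanh2 y : -1 < y < 1 ->
  is_derive y 1 artanh2 (2 / (1 - y ^+ 2)).
Proof.
move=> /andP[y1 y2].
have p1 : 0 < 1 + y by lra.
have p2 : 0 < 1 - y by lra.
have d1 : is_derive (1 + y) 1 (@ln R) (1 + y)^-1 by exact: is_derive1_ln.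
have d2 : is_derive (1 - y) 1 (@ln R) (1 - y)^-1 by exact: is_derive1_ln.
have e1 : is_derive y 1 (fun y : R => 1 + y) 1.
  by apply: is_derive_eq; rewrite ?mulr1 add0r.
have e2 : is_derive y 1 (fun y : R => 1 - y) (-1).
  by apply: is_derive_eq; ring.
have := is_deriveB (@is_derive1_comp R (@ln R) (fun y => 1 + y) y _ _ d1 e1)
  (@is_derive1_comp R (@ln R) (fun y => 1 - y) y _ _ d2 e2).
move=> /is_derive_eq; apply.
rewrite /GRing.scale/=; field.
rewrite !gt_eqF//; have -> : 1 - y ^+ 2 = (1 + y) * (1 - y) by ring.
by rewrite mulr_gt0.
Qed.

Lemma artanh2_bounds z : 0 <= z < 1 -> 2 * z <= artanh2 z <= 2 * z / (1 - z ^+ 2).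
Proof.
move=> /andP[z0 z1].
have [| |xi] := @MVT_segment R artanh2 (fun y => 2 / (1 - y ^+ 2)) 0 z z0.
- by move=> y; rewrite in_itv/= => /andP[y0 yz]; apply: is_derive_artanh2; lra.
- apply: derivable_within_continuous => y; rewrite in_itv/= => /andP[y0 yz].
  have d : is_derive y 1 artanh2 (2 / (1 - y ^+ 2)) by apply: is_derive_artanh2; lra.
  by case: d.
rewrite in_itv/= => /andP[x0 xz].
have -> : artanh2 0 = 0 by rewrite /artanh2 addr0 subr0 subrr.
rewrite !subr0 => ->.
have z2 : 0 < 1 - z ^+ 2 by nra.
have x2 : 0 < 1 - xi ^+ 2 by nra.
apply/andP; split.
  rewrite ler_wpM2r// ler_pdivlMr//; nra.
rewrite [leRHS]mulrAC ler_wpM2r// ler_wpM2l// lef_pV2 ?posrE//; nra.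
Qed.

(** The subtraction formula for tanh; it reduces an increment to one value, to which
    [artanh2_bounds] applies. *)
Lemma artanh2B x y : -1 < x < 1 -> -1 < y < 1 ->
  artanh2 y - artanh2 x = artanh2 ((y - x) / (1 - x * y)).
Proof.
move=> /andP[x1 x2] /andP[y1 y2].
have xy : 0 < 1 - x * y by nra.
have -> : artanh2 ((y - x) / (1 - x * y)) =
    ln ((1 + y) * (1 - x) / (1 - x * y)) - ln ((1 - y) * (1 + x) / (1 - x * y)).
  by congr (ln _ - ln _); field; rewrite gt_eqF.
rewrite !ln_div ?lnM ?posrE ?mulr_gt0//; try lra.
rewrite /artanh2; ring.
Qed.

(** The graph lies above its tangent at [x], which is convexity on [0, 1). After [artanh2B] it comes
    down to [1 - x * y <= 1 - x ^+ 2]. *)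
Lemma artanh2B_ge x y : 0 <= x -> x <= y -> y < 1 ->
  2 * (y - x) / (1 - x ^+ 2) <= artanh2 y - artanh2 x.
Proof.
move=> x0 xy y1.
have p : 0 < 1 - x * y by nra.
have q : 0 < 1 - x ^+ 2 by nra.
rewrite artanh2B; try lra.
set z := (y - x) / (1 - x * y).
have z01 : 0 <= z < 1.
  by rewrite divr_ge0 ?ltr_pdivrMr//=; [nra|lra|lra].
have /andP[h _] := artanh2_bounds z z01.
apply: le_trans h; rewrite -mulrA ler_wpM2l// /z.
rewrite ler_wpM2l ?subr_ge0// lef_pV2 ?posrE//; nra.
Qed.

(** Convexity again: the graph lies below the chord from 0 to [m]. The tangent inequality at [y]
    bounds the increment up to [m] from below, and [artanh2 y <= 2 * y / (1 - y ^+ 2)] compares the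
    value with the slope of that tangent. *)
Lemma artanh2_chord m y : 0 <= y -> y < m -> m < 1 ->
  m * artanh2 y <= y * artanh2 m.
Proof.
move=> y0 ym m1.
have h1 := artanh2B_ge y m y0 (ltW ym) m1.
have /andP[_ h2] : 2 * y <= artanh2 y <= 2 * y / (1 - y ^+ 2).
  by apply: artanh2_bounds; lra.
have h3 := ler_wpM2l y0 h1.
have my : 0 <= m - y by lra.
have h4 := ler_wpM2r my h2.
have : artanh2 y * (m - y) <= y * (artanh2 m - artanh2 y).
  apply: (le_trans h4); apply: le_trans h3.
  by rewrite le_eqVlt; apply/orP; left; apply/eqP; ring.
lra.
Qed.

Lemma ln1D_quadratic x : `|x| <= 2^-1 -> `|ln (1 + x) - x| <= 2 * x ^+ 2.
Proof.
rewrite ler_norml => /andP[x1 x2].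
have p : 0 < 1 + x by lra.
have u := le_ln1Dx (_ : -1 < x); rewrite ler_norml; apply/andP; split; last first.
  have : ln (1 + x) <= x by apply: u; lra.
  by have := sqr_ge0 x; lra.
have : ln (1 + x)^-1 <= (1 + x)^-1 - 1.
  rewrite {1}(_ : (1 + x)^-1 = 1 + ((1 + x)^-1 - 1)); last by lra.
  apply: le_ln1Dx.
  by rewrite ltrBrDl subrr invr_gt0.
rewrite lnV ?posrE// => h.
have : (1 + x)^-1 - 1 <= - x + 2 * x ^+ 2.
  have -> : (1 + x)^-1 - 1 = - x + x ^+ 2 / (1 + x) by field; rewrite gt_eqF.
  rewrite lerD2l mulrC ler_wpM2r ?sqr_ge0//.
  by rewrite invf_ple ?posrE//; lra.
lra.
Qed.
End Artanh.

(** * The mean-field equation *)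

Section Magnetization.
Context {R : realType}.
Implicit Types (beta h m y delta : R).

(** Gathers what the asymptotics use about [m], for both regimes at once. The third condition is the
    fixed-point equation; in the fourth, [beta * (1 - m ^+ 2)] is the slope of [tanh (beta * x + h)]
    at the fixed point, so it says that the fixed point is strictly stable. *)
Definition magnetization beta h m : Prop :=
  [/\ 0 < beta, 0 <= m < 1, artanh2 m = 2 * (beta * m + h), beta * (1 - m ^+ 2) < 1
    & (m = 0 /\ h = 0) \/ (0 < m /\ 0 < h)].

Lemma artanh2_tanh y : artanh2 (tanh y) = 2 * y.
Proof.
have a := expR_gt0 y; have b := expR_gt0 (- y).
rewrite /artanh2 /tanh; set p := expR y in a *; set q := expR (- y) in b *.
have -> : 1 + (p - q) / (p + q) = p * (2 / (p + q)) by field; rewrite gt_eqF// addr_gt0.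
have -> : 1 - (p - q) / (p + q) = q * (2 / (p + q)) by field; rewrite gt_eqF// addr_gt0.
have r0 : 0 < 2 / (p + q) by rewrite divr_gt0 ?addr_gt0.
set r := 2 / _ in r0 *; clearbody r; rewrite !lnM ?posrE//.
by rewrite /p /q !expRK; ring.
Qed.

Lemma tanh_gt0 y : 0 < y -> 0 < tanh y.
Proof.
move=> y0; apply: divr_gt0; last by rewrite addr_gt0 ?expR_gt0.
rewrite subr_gt0 ltr_expR; lra.
Qed.

Lemma tanh_lt1 y : tanh y < 1.
Proof.
by rewrite ltr_pdivrMr ?addr_gt0 ?expR_gt0// mul1r; have := expR_gt0 (- y); lra.
Qed.

(** For [h > 0] a fixed point exists by the intermediate value theorem on [0, 1]. Stability follows
    from [artanh2 m <= 2 * m / (1 - m ^+ 2)]: inserting the equation leaves the positive term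
    [h * (1 - m ^+ 2)], which makes the inequality strict. *)
Lemma mean_spinP beta h : (0 < h /\ 0 < beta) \/ (h = 0 /\ 0 < beta < 1) ->
  magnetization beta h (mean_spin beta h).
Proof.
rewrite /mean_spin => -[[h0 b0]|[-> /andP[b0 b1]]]; last first.
  rewrite eqxx; split => //; rewrite ?lexx ?ltr01//.
  - by rewrite /artanh2 !mulr0 !addr0 subr0 subrr mulr0.
  - by rewrite expr0n subr0 mulr1.
  - by left.
rewrite (gt_eqF h0).
have [m0 m0P] : exists m, [set m : R | 0 < m /\ m = tanh (beta * m + h)] m.
  pose f x := tanh (beta * x + h) - x.
  have cf : continuous f.
    move=> x; apply: cvgB; last exact: cvg_id.
    have cg : {for x, continuous (fun x : R => beta * x + h)}.
      by apply: cvgD; [apply: cvgM; [exact: cvg_cst|exact: cvg_id]|exact: cvg_cst].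
    have ce : {for x, continuous (fun x : R => expR (beta * x + h))}.
      by apply: continuous_comp => //; exact: continuous_expR.
    have ce' : {for x, continuous (fun x : R => expR (- (beta * x + h)))}.
      apply: (@continuous_comp _ _ _ (fun x : R => - (beta * x + h)) expR).
        exact: cvgN.
      exact: continuous_expR.
    apply: cvgM; first exact: cvgB.
    apply: cvgV; last exact: cvgD.
    by rewrite gt_eqF// addr_gt0 ?expR_gt0.
  have f0 : 0 < f 0 by rewrite /f mulr0 add0r subr0 tanh_gt0.
  have f1 : f 1 < 0 by rewrite /f subr_lt0 tanh_lt1.
  have [||c] := @IVT R f 0 1 0 ler01.
  - exact: continuous_subspaceT.
  - by rewrite (min_idPr _) ?(max_idPl _) ?ltW// (lt_trans f1 f0).
  rewrite in_itv/= => /andP[c0 c1] fc; exists c; split; last first.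
    by apply/esym/eqP; rewrite -subr_eq0; apply/eqP.
  by rewrite lt_neqAle c0 andbT; apply/eqP => E; move: fc f0; rewrite -E => ->; rewrite ltxx.
have := xgetPex 0 (ex_intro _ m0 m0P).
set m := xget _ _ => -[mgt mE].
have m1 : m < 1 by rewrite mE tanh_lt1.
have aE : artanh2 m = 2 * (beta * m + h) by rewrite {1}mE artanh2_tanh.
split => //; [by rewrite ltW| |by right].
have /andP[_] : 2 * m <= artanh2 m <= 2 * m / (1 - m ^+ 2).
  by apply: artanh2_bounds; rewrite ltW.
rewrite aE ler_pdivlMr; last by nra.
move=> H; have : m * (beta * (1 - m ^+ 2)) < m * 1.
  have : 0 < h * (1 - m ^+ 2) by rewrite mulr_gt0//; nra.
  lra.
by rewrite ltr_pM2l.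
Qed.

(** Twice the derivative of the mean-field free energy [beta y^2 / 2 + h y - I(y)], where [I] is the
    large deviation rate function of a fair spin. *)
Definition drift beta h y : R := 2 * (beta * y + h) - artanh2 y.

(** The tangent inequality at [m] bounds the drift by [- 2 * ((1 - m ^+ 2)^-1 - beta) * (y - m)],
    and stability makes this coefficient negative. *)
Lemma drift_above beta h m delta : magnetization beta h m -> 0 < delta ->
  exists2 c : R, 0 < c & forall y, m + delta <= y -> y < 1 -> drift beta h y <= - c.
Proof.
move=> [b0 /andP[m0 m1] mE bm _] d0.
have q : 0 < 1 - m ^+ 2 by nra.
have v0 : 0 < (1 - m ^+ 2)^-1 - beta.
  by rewrite subr_gt0 -[X in _ < X]mul1r ltr_pdivlMr.
exists (2 * ((1 - m ^+ 2)^-1 - beta) * delta); first by rewrite !mulr_gt0.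
move=> y my y1.
have my' : m <= y by lra.
have := artanh2B_ge m y m0 my' y1.
rewrite mE /drift; set s := (1 - m ^+ 2)^-1 in v0 * => H.
have : (s - beta) * delta <= (s - beta) * (y - m) by rewrite ler_pM2l//; lra.
move: H; nra.
Qed.

(** The chord inequality gives a drift of at least [2 * h * (m - y) / m]. When [m = 0] the range of
    [y] is empty. *)
Lemma drift_below beta h m delta : magnetization beta h m -> 0 < delta ->
  exists2 c : R, 0 < c & forall y, 0 <= y -> y <= m - delta -> c <= drift beta h y.
Proof.
move=> [b0 /andP[m0 m1] mE bm [[m00 _]|[mgt h0]]] d0.
  by exists 1 => // y; rewrite m00 => ? ?; exfalso; lra.
exists (2 * h * delta / m); first by rewrite divr_gt0 ?mulr_gt0.
move=> y y0 my; have ym : y < m by lra.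
have := artanh2_chord m y y0 ym m1.
rewrite mE /drift ler_pdivrMr// => H.
have : h * delta <= h * (m - y) by rewrite ler_pM2l//; lra.
lra.
Qed.

(** Taylor expansion with quadratic remainder, by writing [1 + y = (1 + m) * (1 + u)] and
    [1 - y = (1 - m) * (1 + w)]. The radius [(1 - m) / 2] keeps [u] and [w] within one half of 0. *)
Lemma drift_local beta h m : magnetization beta h m ->
  exists eps C : R, [/\ 0 < eps, 0 <= C & forall y, `|y - m| <= eps ->
   `|drift beta h y + 2 * ((1 - m ^+ 2)^-1 - beta) * (y - m)| <= C * (y - m) ^+ 2].
Proof.
move=> [b0 /andP[m0 m1] mE _ _].
have p : 0 < 1 - m by lra.
have p' : 0 < 1 + m by lra.
exists ((1 - m) / 2), (2 / (1 + m) ^+ 2 + 2 / (1 - m) ^+ 2); split.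
- by rewrite divr_gt0.
- by rewrite addr_ge0 ?divr_ge0 ?sqr_ge0.
move=> y; rewrite ler_norml => /andP[y1 y2].
set u := (y - m) / (1 + m); set w := - (y - m) / (1 - m).
have hu : `|u| <= 2^-1.
  rewrite ler_norml /u ler_pdivrMr// ler_pdivlMr//; apply/andP; lra.
have hw : `|w| <= 2^-1.
  rewrite ler_norml /w ler_pdivrMr// ler_pdivlMr//; apply/andP; lra.
have y3 : 0 < 1 + y by lra.
have y4 : 0 < 1 - y by lra.
have e1 : ln (1 + u) = ln (1 + y) - ln (1 + m).
  by rewrite -ln_div ?posrE//; congr ln; rewrite /u; field; rewrite gt_eqF.
have e2 : ln (1 + w) = ln (1 - y) - ln (1 - m).
  by rewrite -ln_div ?posrE//; congr ln; rewrite /w; field; rewrite gt_eqF.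
have -> : drift beta h y + 2 * ((1 - m ^+ 2)^-1 - beta) * (y - m) =
   (ln (1 + w) - w) - (ln (1 + u) - u).
  rewrite e1 e2 /drift /artanh2 -[in 2 * (beta * y + h)](subrK m y).
  have := mE; rewrite /artanh2 => mE'.
  have -> : 2 * (beta * (y - m + m) + h) = 2 * beta * (y - m) + 2 * (beta * m + h) by ring.
  rewrite -mE' /u /w.
  have -> : 1 - m ^+ 2 = (1 - m) * (1 + m) by ring.
  by field; rewrite !gt_eqF.
apply: (le_trans (ler_normB _ _)).
have -> : (2 / (1 + m) ^+ 2 + 2 / (1 - m) ^+ 2) * (y - m) ^+ 2 = 2 * w ^+ 2 + 2 * u ^+ 2.
  by rewrite /u /w; field; rewrite !gt_eqF.
by apply: lerD; apply: ln1D_quadratic.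
Qed.

End Magnetization.

(** * The law of the number of positive spins *)

Section Curie_Weiss_weights.
Context {R : realType}.
Implicit Types (beta h m y delta : R).

Lemma geometric_decay (w : nat -> R) (c : R) (a l : nat) :
  (forall i, (a <= i <= a + l)%N -> 0 < w i) ->
  (forall i, (a <= i < a + l)%N -> ln (w i.+1) - ln (w i) <= - c) ->
  w (a + l)%N <= w a * expR (- (c * l%:R)).
Proof.
elim: l => [|l IH] w0 hw; first by rewrite addn0 mulr0 oppr0 expR0 mulr1.
have {}IH : w (a + l)%N <= w a * expR (- (c * l%:R)).
  apply: IH => i /andP[i1 i2].
    by apply: w0; rewrite i1 addnS leqW.
  by apply: hw; rewrite i1 addnS leqW.
have := hw (a + l)%N; rewrite leq_addr addnS ltnSn => /(_ isT) H.
have w1 : 0 < w (a + l)%N by apply: w0; rewrite leq_addr addnS leqW.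
have w2 : 0 < w (a + l).+1 by apply: w0; rewrite addnS leqnn -addnS leq_addr.
rewrite -(natr1 l) -[w _.+1]lnK ?posrE//.
apply: (@le_trans _ _ (expR (ln (w (a + l)%N)) * expR (- c))).
  by rewrite -expRD ler_expR; lra.
rewrite lnK ?posrE//.
have -> : - (c * (l%:R + 1)) = - (c * l%:R) - c by ring.
by rewrite expRD mulrA ler_wpM2r// expR_ge0.
Qed.

Lemma geometric_growth (w : nat -> R) (c : R) (a l : nat) :
  (forall i, (a <= i <= a + l)%N -> 0 < w i) ->
  (forall i, (a <= i < a + l)%N -> c <= ln (w i.+1) - ln (w i)) ->
  w a <= w (a + l)%N * expR (- (c * l%:R)).
Proof.
elim: l => [|l IH] w0 hw; first by rewrite addn0 mulr0 oppr0 expR0 mulr1.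
have {}IH : w a <= w (a + l)%N * expR (- (c * l%:R)).
  apply: IH => i /andP[i1 i2].
    by apply: w0; rewrite i1 addnS leqW.
  by apply: hw; rewrite i1 addnS leqW.
have := hw (a + l)%N; rewrite leq_addr addnS ltnSn => /(_ isT) H.
have w1 : 0 < w (a + l)%N by apply: w0; rewrite leq_addr addnS leqW.
have w2 : 0 < w (a + l).+1 by apply: w0; rewrite addnS leqnn -addnS leq_addr.
rewrite -(natr1 l); apply: (le_trans IH).
have -> : - (c * (l%:R + 1)) = - c - c * l%:R by ring.
rewrite expRD mulrA ler_wpM2r ?expR_ge0//.
rewrite -{1}[w (a + l)%N]lnK ?posrE// -[w _.+1]lnK ?posrE//.
by rewrite -expRD ler_expR; lra.
Qed.

(** Total weight of the configurations with [j] positive spins, the pair sum being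
    [(W ^+ 2 - n) / 2] with [W = 2 j - n]. The constant factor from the diagonal term is left out
    and cancels against the normalisation. *)
Definition cw_pt beta h (n j : nat) : R :=
  'C(n, j)%:R * expR (beta / (2 * n%:R) * (2 * j%:R - n%:R) ^+ 2 + h * (2 * j%:R - n%:R)).

Definition cw_total beta h (n : nat) : R := \sum_(0 <= j < n.+1) cw_pt beta h n j.

Definition cw_pmf beta h (n j : nat) : R := cw_pt beta h n j / cw_total beta h n.

Lemma cw_pt_ge0 beta h n j : 0 <= cw_pt beta h n j.
Proof. by rewrite mulr_ge0 ?expR_ge0. Qed.

Lemma cw_pt_gt0 beta h n j : (j <= n)%N -> 0 < cw_pt beta h n j.
Proof. by move=> jn; rewrite mulr_gt0 ?expR_gt0// ltr0n bin_gt0. Qed.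

Lemma cw_total_gt0 beta h n : 0 < cw_total beta h n.
Proof.
rewrite /cw_total big_nat_recr//= ltr_wpDl ?cw_pt_gt0// sumr_ge0// => i _.
exact: cw_pt_ge0.
Qed.

Lemma cw_pmf_ge0 beta h n j : 0 <= cw_pmf beta h n j.
Proof. by rewrite divr_ge0 ?cw_pt_ge0// ltW// cw_total_gt0. Qed.

Lemma cw_pmf_gt0 beta h n j : (j <= n)%N -> 0 < cw_pmf beta h n j.
Proof. by move=> jn; rewrite divr_gt0 ?cw_pt_gt0// cw_total_gt0. Qed.

Lemma sum_cw_pmf beta h n : \sum_(0 <= j < n.+1) cw_pmf beta h n j = 1.
Proof. by rewrite /cw_pmf -big_distrl/= divff// gt_eqF// cw_total_gt0. Qed.

Lemma cw_pmf_le1 beta h n j : cw_pmf beta h n j <= 1.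
Proof.
case: (leqP j n) => jn; last by rewrite /cw_pmf /cw_pt bin_small// mul0r mul0r.
rewrite -(sum_cw_pmf beta h n) (bigD1_seq j) ?mem_index_iota ?iota_uniq//=.
by rewrite lerDl sumr_ge0// => i _; exact: cw_pmf_ge0.
Qed.

Lemma cw_pmf_mirror beta h n j : (j <= n)%N ->
  cw_pmf beta h n j = cw_pmf beta h n (n - j) * expR (- (2 * h * (n%:R - 2 * j%:R))).
Proof.
move=> jn; rewrite /cw_pmf [RHS]mulrAC; congr (_ * _); rewrite /cw_pt bin_sub// -[RHS]mulrA -expRD.
congr (_ * expR _); rewrite natrB//.
have -> : 2 * (n%:R - j%:R) - n%:R = - (2 * j%:R - n%:R) :> R by ring.
by rewrite sqrrN; ring.
Qed.

(* This [y] makes (n - j) / (j + 1) = (1 - y) / (1 + y) exactly, while the energy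
   increment involves y (n + 1) / n, whence the correction term. *)
Lemma cw_pmf_ratio beta h n j : (j < n)%N ->
  let y := (2 * j%:R + 1 - n%:R) / (n%:R + 1) in
  ln (cw_pmf beta h n j.+1) - ln (cw_pmf beta h n j) =
  drift beta h y + 2 * beta * y / n%:R.
Proof.
move=> jn y.
have n0 : 0 < n%:R :> R by rewrite ltr0n (leq_ltn_trans _ jn).
have n1 : 0 < n%:R + 1 :> R by lra.
have jn' : 0 < n%:R - j%:R :> R by rewrite subr_gt0 ltr_nat.
have j1 : 0 < j%:R + 1 :> R by rewrite ltr_pwDr.
have c0 : 0 < 'C(n, j)%:R :> R by rewrite ltr0n bin_gt0 ltnW.
have c1 : 0 < 'C(n, j.+1)%:R :> R by rewrite ltr0n bin_gt0.
rewrite /cw_pmf !ln_div ?posrE ?cw_total_gt0 ?cw_pt_gt0//; last exact: ltnW.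
rewrite /cw_pt !lnM ?posrE ?expR_gt0// !expRK.
have bE : (j%:R + 1) * 'C(n, j.+1)%:R = (n%:R - j%:R) * 'C(n, j)%:R :> R.
  by rewrite natr1 -natrB ?(ltnW jn)// -!natrM mul_bin_left.
have -> : 'C(n, j.+1)%:R = (n%:R - j%:R) / (j%:R + 1) * 'C(n, j)%:R :> R.
  by rewrite mulrAC -bE; field; rewrite gt_eqF.
rewrite lnM ?posrE ?divr_gt0// ln_div ?posrE//.
rewrite /drift /artanh2.
have -> : 1 + y = (j%:R + 1) * (2 / (n%:R + 1)) by rewrite /y; field; rewrite gt_eqF.
have -> : 1 - y = (n%:R - j%:R) * (2 / (n%:R + 1)) by rewrite /y; field; rewrite gt_eqF.
have r0 : 0 < 2 / (n%:R + 1) :> R by rewrite divr_gt0.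
rewrite !lnM ?posrE// /y -(natr1 j).
clear r0 bE; move: (ln _) (ln _) (ln _) (ln _) (ln _) => *.
by field; rewrite !gt_eqF.
Qed.

End Curie_Weiss_weights.

(** * Local ratio and tail estimates for the Curie-Weiss law *)

Section Curie_Weiss_asymptotics.
Context {R : realType}.
Implicit Types (beta h m y delta : R).

(** One factor 2 is the one in [drift], the other arises because [y] moves by about [2 / n] when [j]
    moves by one. *)
Definition cw_kappa beta m : R := 4 * ((1 - m ^+ 2)^-1 - beta).

Lemma cw_kappa_gt0 beta h m : magnetization beta h m -> 0 < cw_kappa beta m.
Proof.
move=> [b0 /andP[m0 m1] _ bm _]; rewrite mulr_gt0// subr_gt0.
by rewrite -[X in _ < X]mul1r ltr_pdivlMr//; nra.
Qed.

Lemma cw_pmf_local beta h m : magnetization beta h m ->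
  exists eps C B : R, [/\ 0 < eps, 0 <= C & forall (n j j0 : nat),
  B <= n%:R -> (j < n)%N -> `|2 * j0%:R - n%:R * (1 + m)| <= 2 ->
  `|j%:R - j0%:R| <= eps * n%:R ->
  `|ln (cw_pmf beta h n j.+1) - ln (cw_pmf beta h n j)
    + cw_kappa beta m * (j%:R - j0%:R) / n%:R|
    <= C * (n%:R^-1 + ((j%:R - j0%:R) / n%:R) ^+ 2)].
Proof.
move=> mag; have [eps [C1 [e0 C10 loc]]] := drift_local beta h m mag.
have := cw_kappa_gt0 beta h m mag; rewrite /cw_kappa.
case: mag => b0 /andP[m0 m1] _ _ _.
set v := _ - beta in loc *; rewrite pmulr_rgt0// => v0.
(* The distance from [y] to [m] is at most [(2 |t| + 4) / (n + 1)], so [eps / 4] and [8 / eps] keep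
   it below [eps]. In the constant, [32 * C1] comes from squaring this bound, [12 * v] from the
   rounding of the centre and from [n + 1] against [n], and [2 * beta] from the correction term of
   [cw_pmf_ratio]. *)
exists (Num.min 1 (eps / 4)), (32 * C1 + 12 * v + 2 * beta), (8 / eps); split.
- by rewrite lt_min ltr01 divr_gt0.
- by rewrite !addr_ge0// mulr_ge0// ltW.
move=> n j j0 nB jn j0P jE.
have n0 : 0 < n%:R :> R by rewrite ltr0n (leq_ltn_trans _ jn).
have n1 : 0 < n%:R + 1 :> R by lra.
have nn1 : 1 <= n%:R :> R by rewrite ler1n -(ltr0n R).
rewrite cw_pmf_ratio//=; set y := (_ / _).
set t := j%:R - j0%:R in jE *.
set N : R := n%:R in nB j0P jE n0 n1 nn1 y *.
pose rho := 2 * j0%:R + 1 - N - N * m - m.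
have rhoP : `|rho| <= 4.
  move: j0P; rewrite !ler_norml /rho => /andP[? ?]; apply/andP; lra.
have ym : y - m = (2 * t + rho) / (N + 1).
  by rewrite /y /t /rho; field; rewrite gt_eqF.
have tN : `|t| <= N.
  by apply: (le_trans jE); rewrite ger_pMl// ge_min lexx.
have te : `|t| <= eps / 4 * N.
  by apply: (le_trans jE); rewrite ler_wpM2r ?(ltW n0)// ge_min lexx orbT.
have y1 : `|y| <= 1.
  rewrite ler_norml /y ler_pdivrMr// ler_pdivlMr//.
  have : j%:R + 1 <= N by rewrite natr1 ler_nat.
  by have := ler0n R j; move=> ? ?; apply/andP; lra.
clearbody y.
have tr : `|2 * t + rho| <= 2 * `|t| + 4.
  apply: (le_trans (ler_normD _ _)); rewrite normrM ger0_norm//; lra.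
have yme : `|y - m| <= eps.
  rewrite ym normrM normfV (gtr0_norm n1) ler_pdivrMr//.
  apply: (le_trans tr).
  have : 8 <= N * eps by move: nB; rewrite ler_pdivrMr//.
  lra.
have -> : drift beta h y + 2 * beta * y / N + 4 * v * t / N =
  (drift beta h y + 2 * v * (y - m)) + 2 * beta * y / N
   + 2 * v * (2 * t - rho * N) / (N * (N + 1)).
  by rewrite ym; field; rewrite !gt_eqF.
have h1 : C1 * (y - m) ^+ 2 <= C1 * (8 * (t / N) ^+ 2 + 32 * N^-1).
  rewrite ler_wpM2l// -real_normK ?num_real//.
  have : `|y - m| <= (2 * `|t| + 4) / N.
    rewrite ym normrM normfV (gtr0_norm n1).
    apply: ler_pM => //; first by rewrite invr_ge0 ltW.
    by rewrite lef_pV2 ?posrE//; lra.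
  move=> H; apply: (@le_trans _ _ (((2 * `|t| + 4) / N) ^+ 2)).
    by rewrite lerXn2r ?nnegrE// divr_ge0 ?(ltW n0)// addr_ge0 ?mulr_ge0.
  apply: (@le_trans _ _ (8 * (t / N) ^+ 2 + 32 / N ^+ 2)); last first.
    rewrite lerD2l ler_wpM2l// lef_pV2 ?posrE ?exprn_gt0// ler_eXnr//.
  have -> : 8 * (t / N) ^+ 2 + 32 / N ^+ 2 = (8 * `|t| ^+ 2 + 32) / N ^+ 2.
    by rewrite real_normK ?num_real//; field; rewrite gt_eqF.
  rewrite exprMn exprVn ler_wpM2r ?invr_ge0 ?sqr_ge0//.
  by have := sqr_ge0 (2 * `|t| - 4); lra.
have h2 : `|2 * beta * y / N| <= 2 * beta * N^-1.
  rewrite !normrM normfV (gtr0_norm n0) (gtr0_norm b0) ger0_norm//.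
  rewrite ler_wpM2r ?invr_ge0 ?(ltW n0)// ler_piMr// mulr_ge0// ltW//.
have h3 : `|2 * v * (2 * t - rho * N) / (N * (N + 1))| <= 12 * v * N^-1.
  rewrite normrM normfV [`|N * _|]gtr0_norm ?mulr_gt0// ler_pdivrMr ?mulr_gt0//.
  have -> : 12 * v * N^-1 * (N * (N + 1)) = 2 * v * (6 * (N + 1)) by field; rewrite gt_eqF.
  rewrite normrM ger0_norm ?mulr_ge0 ?(ltW v0)// ler_pM2l ?mulr_gt0//.
  apply: (le_trans (ler_normB _ _)); rewrite !normrM (gtr0_norm n0) (@ger0_norm _ 2)//.
  have := ler_wpM2r (ltW n0) rhoP; lra.
apply: (le_trans (ler_normD _ _)); apply: (le_trans (lerD (ler_normD _ _) (lexx _))).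
have := loc y yme; move: h1 h2 h3.
set A := N^-1; set B := (t / N) ^+ 2.
have A0 : 0 <= A by rewrite invr_ge0 ltW.
have B0 : 0 <= B by rewrite sqr_ge0.
have : 0 <= C1 * B by rewrite mulr_ge0.
have : 0 <= v * B by rewrite mulr_ge0 // ltW.
have : 0 <= beta * B by rewrite mulr_ge0 // ltW.
clearbody A B; move: (`| _ |) (`| _ |) (`| _ |) (C1 * _ ^+ 2) => *; lra.
Qed.

(** From [j] one walks about [delta * n / 8] steps towards the centre. All along the walk the
    logarithm of the law grows by at least [c] per step, and at its end the law is at most 1, so its
    value at [j] is exponentially small in [n]. *)
Lemma cw_tail_pos beta h m delta : magnetization beta h m -> 0 < delta ->
  exists2 K : R, 0 <= K & forall n j : nat, (0 < n)%N -> (j <= n)%N -> (n <= 2 * j)%N ->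
  delta * n%:R <= `|2 * j%:R - n%:R * (1 + m)| -> cw_pmf beta h n j <= K / n%:R ^+ 2.
Proof.
move=> mag d0; have d20 : 0 < delta / 2 by lra.
have [c1 c10 up] := drift_above beta h m (delta / 2) mag d20.
have [c2 c20 down] := drift_below beta h m (delta / 2) mag d20.
case: mag => b0 /andP[m0 m1] _ _ _.
pose c := Num.min (c1 / 2) c2.
have c0 : 0 < c by rewrite lt_min c20 divr_gt0.
have cd0 : 0 < c * (delta / 8) by rewrite mulr_gt0 ?divr_gt0.
have [K K0 HK] := expRN_le_inv_sqr _ cd0.
(* Beyond [B] the correction [2 * beta * y / n] costs at most half of [c1]; for smaller [n] the
   trivial bound 1 is at most [B ^+ 2 / n ^+ 2]. *)
pose B := 2 + 4 * beta / c1.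
have B0 : 0 < B by apply: addr_gt0 => //; apply: divr_gt0 => //; apply: mulr_gt0.
exists (expR c * K + B ^+ 2).
  by apply: addr_ge0; [rewrite mulr_ge0 ?expR_ge0|exact: sqr_ge0].
move=> n j n_gt0 jn nj far.
have n0 : 0 < n%:R :> R by rewrite ltr0n.
case: (leP n%:R B) => nB.
  apply: (le_trans (cw_pmf_le1 _ _ _ _)); rewrite ler_pdivlMr ?exprn_gt0// mul1r.
  apply: (@le_trans _ _ (B ^+ 2)); last by rewrite lerDr mulr_ge0 ?expR_ge0.
  by rewrite lerXn2r ?nnegrE ?(ltW B0) ?(ltW nB).
have n2 : 2 <= n%:R :> R.
  by apply/ltW/le_lt_trans/nB; rewrite lerDl divr_ge0 ?mulr_ge0 ?ltW.
have nb : 2 * beta / n%:R <= c1 / 2.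
  have : 4 * beta / c1 <= n%:R by apply/ltW/le_lt_trans/nB; rewrite lerDr.
  rewrite ler_pdivrMr// => H; rewrite ler_pdivrMr//; lra.
(* A step moves [y] by [2 / (n + 1)], so the walk covers at most [delta / 4] and stays at least
   [delta / 2] away from [m]. *)
pose l := Num.truncn (delta / 8 * n%:R).
have dn0 : 0 <= delta / 8 * n%:R by rewrite mulr_ge0 ?divr_ge0// ltW.
have /andP[l1 l2] : l%:R <= delta / 8 * n%:R < l.+1%:R := truncn_itv dn0.
have l3 : delta / 8 * n%:R - 1 <= l%:R by move: l2; rewrite -(natr1 l); lra.
clearbody l.
have fin : expR (- (c * l%:R)) <= (expR c * K + B ^+ 2) / n%:R ^+ 2.
  apply: (@le_trans _ _ (expR c * (K / n%:R ^+ 2))).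
    apply: (@le_trans _ _ (expR c * expR (- (c * (delta / 8) * n%:R)))).
      rewrite -expRD ler_expR; have := ler_wpM2l (ltW c0) l3; lra.
    by rewrite ler_wpM2l ?expR_ge0// HK.
  by rewrite mulrA ler_wpM2r ?invr_ge0 ?sqr_ge0// lerDl sqr_ge0.
have dn : delta * 2 <= delta * n%:R by rewrite ler_pM2l.
have n1 : 0 < n%:R + 1 :> R by lra.
have mn : 0 <= n%:R * m by rewrite mulr_ge0// ltW.
have mn1 : n%:R * m <= n%:R by rewrite ger_pMr// ltW.
have nj' : n%:R <= 2 * j%:R :> R by rewrite -natrM ler_nat.
have jn' : j%:R <= n%:R :> R by rewrite ler_nat.
move: far; rewrite ler_normr => /orP[far|far].
  have lj : (l <= j)%N by rewrite -(ler_nat R); lra.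
  have jE : (j - l + l = j)%N by rewrite subnK.
  have jl : (j - l)%:R = j%:R - l%:R :> R by rewrite natrB.
  have := @geometric_decay R (cw_pmf beta h n) c (j - l) l; rewrite jE => H.
  apply: le_trans (le_trans (H _ _) _) fin.
  - by move=> i /andP[_ ij]; apply: cw_pmf_gt0; exact: leq_trans ij jn.
  - move=> i /andP[i1 i2]; have iin : (i < n)%N by exact: leq_trans i2 jn.
    have ij1 : j%:R - l%:R <= i%:R :> R by rewrite -jl ler_nat.
    have ij2 : i%:R + 1 <= j%:R :> R by rewrite natr1 ler_nat.
    rewrite cw_pmf_ratio//=; set y := _ / _.
    have y1 : y < 1 by rewrite ltr_pdivrMr//; lra.
    have my : m + delta / 2 <= y by rewrite ler_pdivlMr//; lra.
    have := up y my y1.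
    have : 2 * beta * y / n%:R <= 2 * beta / n%:R.
      by rewrite ler_wpM2r ?invr_ge0 ?(ltW n0)// ler_piMr ?mulr_ge0 ?(ltW b0)// ltW.
    have : c <= c1 / 2 by rewrite ge_min lexx.
    lra.
  - by rewrite -[leRHS]mul1r ler_wpM2r ?expR_ge0// cw_pmf_le1.
have jln : (j + l <= n)%N by rewrite -(ler_nat R) natrD; lra.
have := @geometric_growth R (cw_pmf beta h n) c j l => H.
apply: le_trans (le_trans (H _ _) _) fin.
- by move=> i /andP[_ ij]; apply: cw_pmf_gt0; exact: leq_trans ij jln.
- move=> i /andP[i1 i2]; have iin : (i < n)%N by exact: leq_trans i2 jln.
  have ij1 : j%:R <= i%:R :> R by rewrite ler_nat.
  have ij2 : i%:R + 1 <= j%:R + l%:R :> R by rewrite natr1 -natrD ler_nat.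
  rewrite cw_pmf_ratio//=; set y := _ / _.
  have y0 : 0 <= y by rewrite divr_ge0//; lra.
  have my : y <= m - delta / 2 by rewrite ler_pdivrMr//; lra.
  have := down y y0 my.
  have : 0 <= 2 * beta * y / n%:R.
    apply: divr_ge0; last exact: ltW.
    by apply: mulr_ge0 => //; apply: mulr_ge0 => //; exact: ltW.
  have : c <= c2 by rewrite ge_min lexx orbT.
  lra.
- by rewrite -[leRHS]mul1r ler_wpM2r ?expR_ge0// cw_pmf_le1.
Qed.

(** It remains to reflect [j] to [n - j] when [W < 0]. For [h = 0] the law is symmetric about
    [m = 0]. For [h > 0] there are two cases: if [- W <= n * m / 2], the reflected point is itself
    at distance at least [n * m / 2] below the centre, and [cw_tail_pos] applies to it; otherwise
    the factor [expR (- (2 * h * (n - 2 j)))] is at most [expR (- (h * m * n))]. *)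
Lemma cw_tail beta h m delta : magnetization beta h m -> 0 < delta ->
  exists2 K : R, 0 <= K & forall n j : nat, (0 < n)%N -> (j <= n)%N ->
  delta * n%:R <= `|2 * j%:R - n%:R * (1 + m)| -> cw_pmf beta h n j <= K / n%:R ^+ 2.
Proof.
move=> mag d0; have [K1 K10 H1] := cw_tail_pos beta h m delta mag d0.
have magE := mag; case: mag => b0 /andP[m0 m1] _ _ mh.
case: mh => [[mE hE]|[mgt h0]].
  exists K1 => // n j n0 jn far; case: (leqP n (2 * j)) => nj; first exact: H1.
  rewrite cw_pmf_mirror// hE mulr0 mul0r oppr0 expR0 mulr1; rewrite -hE.
  have nj2 : (n <= 2 * (n - j))%N by clear -nj jn; lia.
  apply: (H1 n (n - j)%N n0 (leq_subr _ _) nj2).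
  move: far; rewrite mE addr0 mulr1 natrB// => /le_trans; apply.
  have -> : 2 * (n%:R - j%:R) - n%:R = - (2 * j%:R - n%:R) :> R by ring.
  by rewrite normrN.
have d2 : 0 < m / 2 by lra.
have [K2 K20 H2] := cw_tail_pos beta h m (m / 2) magE d2.
have hm0 : 0 < h * m by rewrite mulr_gt0.
have [K3 K30 H3] := expRN_le_inv_sqr _ hm0.
exists (K1 + K2 + K3); first by rewrite !addr_ge0.
move=> n j n0 jn far.
have nn : 0 < n%:R :> R by rewrite ltr0n.
have inv0 : 0 <= (n%:R ^+ 2)^-1 :> R by rewrite invr_ge0 sqr_ge0.
case: (leqP n (2 * j)) => nj.
  by apply: (le_trans (H1 n j n0 jn nj far)); rewrite ler_wpM2r//; lra.
have nj' : 2 * j%:R <= n%:R :> R by rewrite -natrM ler_nat ltnW.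
have nj2 : (n <= 2 * (n - j))%N by clear -nj jn; lia.
rewrite cw_pmf_mirror//.
have e1 : expR (- (2 * h * (n%:R - 2 * j%:R))) <= 1.
  by rewrite expR_le1 oppr_le0 !mulr_ge0 ?subr_ge0 ?(ltW h0).
case: (leP (n%:R - 2 * j%:R) (n%:R * m / 2)) => c.
  have : cw_pmf beta h n (n - j) <= K2 / n%:R ^+ 2.
    apply: (H2 n (n - j)%N n0 (leq_subr _ _) nj2).
    rewrite natrB// ler_normr; apply/orP; right; lra.
  move=> H; apply: (@le_trans _ _ (K2 / n%:R ^+ 2 * 1)).
    by apply: ler_pM; rewrite ?cw_pmf_ge0 ?expR_ge0.
  by rewrite mulr1 ler_wpM2r//; lra.
apply: (@le_trans _ _ (1 * (K3 / n%:R ^+ 2))).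
  apply: ler_pM; rewrite ?cw_pmf_ge0 ?expR_ge0 ?cw_pmf_le1//.
  apply: le_trans (H3 n%:R nn); rewrite ler_expR lerN2.
  have := ler_wpM2l (ltW h0) (ltW c); lra.
by rewrite mul1r ler_wpM2r//; lra.
Qed.

End Curie_Weiss_asymptotics.

(** * Poisson laws *)

Section Poisson.
Context {R : realType}.
Implicit Types (lambda theta kappa delta N : R) (B : set nat).

Lemma poisson_pmf_gt0 lambda i : 0 < poisson_pmf lambda i.
Proof.
rewrite /poisson_pmf; case: ifPn => // l0.
by rewrite !mulr_gt0 ?expR_gt0 ?exprn_gt0// invr_gt0 ltr0n fact_gt0.
Qed.

Lemma poisson_prob1 lambda k i : 0 < lambda ->
  poisson_prob lambda k [set i] = (poisson_pmf lambda i)%:E.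
Proof.
by move=> l0; rewrite /poisson_prob l0 esum_set1// lee_fin poisson_pmf_ge0.
Qed.

Lemma poisson_pmf_ratio lambda i : 0 < lambda ->
  ln (poisson_pmf lambda i.+1) - ln (poisson_pmf lambda i) =
  - ln (1 + (i%:R + 1 - lambda) / lambda).
Proof.
move=> l0; have i1 : 0 < i%:R + 1 :> R by rewrite ltr_pwDr.
have -> : 1 + (i%:R + 1 - lambda) / lambda = (lambda / (i%:R + 1))^-1.
  by rewrite invf_div; field; rewrite gt_eqF.
rewrite lnV ?posrE ?divr_gt0// opprK.
have -> : poisson_pmf lambda i.+1 = poisson_pmf lambda i * (lambda / (i%:R + 1)).
  rewrite /poisson_pmf l0 exprS factS natrM -natr1.
  have f0 : i`!%:R != 0 :> R by rewrite pnatr_eq0 -lt0n fact_gt0.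
  by field; rewrite f0 gt_eqF.
by rewrite lnM ?posrE ?poisson_pmf_gt0 ?divr_gt0// addrAC subrr add0r.
Qed.

Lemma poisson_pmf_local kappa : 0 < kappa ->
  exists eps C B : R, [/\ 0 < eps, 0 <= C & forall N lambda (i i0 : nat),
  B <= N -> 0 < N -> `|lambda - N / kappa| <= 1 -> `|i0%:R - lambda| <= 1 ->
  `|i%:R - i0%:R| <= eps * N ->
  `|ln (poisson_pmf lambda i.+1) - ln (poisson_pmf lambda i)
    + kappa * (i%:R - i0%:R) / N| <= C * (N^-1 + ((i%:R - i0%:R) / N) ^+ 2)].
Proof.
(* The threshold gives [lambda >= N / (2 * kappa)]. Together with [eps] it keeps [x / lambda] within
   one half of 0, the range of the quadratic bound for [ln]. *)
move=> k0; exists (Num.min 1 ((8 * kappa)^-1)), (4 * kappa + 82 * kappa ^+ 2), (1 + 16 * kappa).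
split.
- by rewrite lt_min ltr01 invr_gt0 mulr_gt0.
- by rewrite addr_ge0// mulr_ge0 ?sqr_ge0// ltW.
move=> N lambda i i0 NB N0 lN il tE.
have lge : N / (2 * kappa) <= lambda.
  have h : N / kappa - 1 <= lambda by move: lN; rewrite ler_norml => /andP[? ?]; lra.
  apply: le_trans h; rewrite -subr_ge0.
  have -> : N / kappa - 1 - N / (2 * kappa) = (N - 2 * kappa) / (2 * kappa).
    by field; rewrite gt_eqF.
  by apply: divr_ge0; [lra|rewrite mulr_ge0// ltW].
have l0 : 0 < lambda by apply: lt_le_trans lge; rewrite divr_gt0 ?mulr_gt0.
rewrite poisson_pmf_ratio//.
have linv : lambda^-1 <= 2 * kappa / N.
  by rewrite -invf_div lef_pV2// posrE divr_gt0 ?mulr_gt0.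
set t := i%:R - i0%:R in tE *; set x := i%:R + 1 - lambda.
have tN : `|t| <= N by apply: (le_trans tE); rewrite ger_pMl// ge_min lexx.
have te : `|t| <= (8 * kappa)^-1 * N.
  by apply: (le_trans tE); rewrite ler_wpM2r ?(ltW N0)// ge_min lexx orbT.
have te' : kappa * `|t| <= N / 8.
  by apply: (le_trans (ler_wpM2l (ltW k0) te)); rewrite le_eqVlt; apply/orP; left; apply/eqP;
    field; rewrite gt_eqF.
have xt : `|x - t| <= 2.
  have -> : x - t = 1 + (i0%:R - lambda) by rewrite /x /t; ring.
  apply: (le_trans (ler_normD _ _)); rewrite normr1; lra.
have xb : `|x| <= `|t| + 2.
  have -> : x = t + (x - t) by ring.
  apply: (le_trans (ler_normD _ _)); lra.
have xl : `|x / lambda| <= (`|t| + 2) * (2 * kappa / N).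
  rewrite normrM normfV (gtr0_norm l0); apply: ler_pM => //.
  by rewrite invr_ge0 ltW.
clearbody t x.
have xl2 : `|x / lambda| <= 2^-1.
  apply: (le_trans xl); rewrite mulrA ler_pdivrMr//; lra.
have q := ln1D_quadratic _ xl2.
have -> : - ln (1 + x / lambda) + kappa * t / N =
  - (ln (1 + x / lambda) - x / lambda) - (x - t) / lambda + t * (kappa * (lambda - N / kappa) / (N * lambda)).
  by field; rewrite !gt_eqF.
have h1 : `|- (ln (1 + x / lambda) - x / lambda)| <= 16 * kappa ^+ 2 * ((t / N) ^+ 2 + 4 * N^-1).
  rewrite normrN; apply: (le_trans q).
  have : (x / lambda) ^+ 2 <= ((`|t| + 2) * (2 * kappa / N)) ^+ 2.
    rewrite -(real_normK (num_real (x / lambda))) lerXn2r ?nnegrE//.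
    by apply: mulr_ge0; [rewrite addr_ge0|apply: divr_ge0; [rewrite mulr_ge0// ltW|exact: ltW]].
  have -> : ((`|t| + 2) * (2 * kappa / N)) ^+ 2 = 4 * kappa ^+ 2 * ((`|t| + 2) / N) ^+ 2.
    by field; rewrite gt_eqF.
  have : ((`|t| + 2) / N) ^+ 2 <= 2 * (t / N) ^+ 2 + 8 * N^-1.
    apply: (@le_trans _ _ (2 * (t / N) ^+ 2 + 8 / N ^+ 2)); last first.
      by rewrite lerD2l ler_wpM2l// lef_pV2 ?posrE ?exprn_gt0// ler_eXnr//; lra.
    have -> : 2 * (t / N) ^+ 2 + 8 / N ^+ 2 = (2 * `|t| ^+ 2 + 8) / N ^+ 2.
      by rewrite real_normK ?num_real//; field; rewrite gt_eqF.
    rewrite exprMn exprVn ler_wpM2r ?invr_ge0 ?sqr_ge0//.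
    by have := sqr_ge0 (`|t| - 2); lra.
  have k20 : 0 <= 8 * kappa ^+ 2 by rewrite mulr_ge0 ?sqr_ge0.
  move=> a; have := ler_wpM2l k20 a; lra.
have h2 : `|(x - t) / lambda| <= 4 * kappa * N^-1.
  rewrite normrM normfV (gtr0_norm l0).
  have -> : 4 * kappa * N^-1 = 2 * (2 * kappa / N) by ring.
  by apply: ler_pM => //; rewrite invr_ge0 ltW.
have h3 : `|t * (kappa * (lambda - N / kappa) / (N * lambda))| <= 2 * kappa ^+ 2 * N^-1.
  rewrite !normrM normfV normrM (gtr0_norm l0) (gtr0_norm N0) (gtr0_norm k0).
  have -> : 2 * kappa ^+ 2 * N^-1 = N * (kappa * 1 * (N^-1 * (2 * kappa / N))).
    by field; rewrite gt_eqF.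
  apply: ler_pM => //.
    by apply: mulr_ge0; [rewrite mulr_ge0// ltW|rewrite invr_ge0 mulr_ge0// ltW].
  apply: ler_pM; [by rewrite mulr_ge0// ltW|by rewrite invr_ge0 mulr_ge0// ltW| |].
    by rewrite ler_pM2l.
  by rewrite invfM ler_pM2l ?invr_gt0.
apply: (le_trans (ler_normD _ _)); apply: (le_trans (lerD (ler_normB _ _) (lexx _))).
move: h1 h2 h3; set A := N^-1; set D := (t / N) ^+ 2.
have A0 : 0 <= A by rewrite invr_ge0 ltW.
have D0 : 0 <= D by rewrite sqr_ge0.
have : 0 <= kappa * D by rewrite mulr_ge0// ltW.
have : 0 <= kappa ^+ 2 * D by rewrite mulr_ge0 ?sqr_ge0.
have : 0 <= kappa ^+ 2 * A by rewrite mulr_ge0 ?sqr_ge0.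
clearbody A D; move: (`| _ |) (`| _ |) (`| _ |) (kappa ^+ 2) => *; lra.
Qed.

(** With [theta = s ^+ 2], the bound [ln s^-1 <= s^-1 - 1] makes the expression at least
    [(s - 1) ^+ 2]. Passing to the square root is what yields a strict inequality from the
    non-strict bound on [ln]. *)
Lemma chernoff_exponent_gt0 theta : 0 < theta -> theta != 1 ->
  0 < theta * ln theta - theta + 1.
Proof.
move=> t0 t1; pose s := Num.sqrt theta.
have s0 : 0 < s by rewrite sqrtr_gt0.
have tE : theta = s ^+ 2 by rewrite sqr_sqrtr// ltW.
have s1 : s - 1 != 0.
  by rewrite subr_eq0; apply: contra t1; rewrite tE => /eqP ->; rewrite expr1n.
have : ln s^-1 <= s^-1 - 1.
  rewrite {1}(_ : s^-1 = 1 + (s^-1 - 1)); last by ring.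
  by apply: le_ln1Dx; rewrite ltrBrDl subrr invr_gt0.
rewrite lnV ?posrE// => h; rewrite tE lnXn//.
have s2 : 0 <= 2 * s ^+ 2 by rewrite mulr_ge0 ?sqr_ge0.
have := ler_wpM2l s2 h.
have -> : 2 * s ^+ 2 * (s^-1 - 1) = 2 * s - 2 * s ^+ 2 by field; rewrite gt_eqF.
have : 0 < (s - 1) ^+ 2 by rewrite lt_neqAle sqr_ge0 andbT eq_sym sqrf_eq0.
rewrite -[ln s *+ 2]mulr_natl; lra.
Qed.

(* Exponential tilting: compare with the Poisson law of mean [theta * lambda]. *)
Lemma poisson_chernoff lambda theta k B : 0 < lambda -> 0 < theta ->
  (forall i, B i -> 0 <= (i%:R - theta * lambda) * ln theta) ->
  (poisson_prob lambda k B <=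
   (expR (- ((theta * ln theta - theta + 1) * lambda)))%:E)%E.
Proof.
move=> l0 t0 hB; set E := expR _.
have tl0 : 0 < theta * lambda by rewrite mulr_gt0.
have pw i : B i -> poisson_pmf lambda i <= E * poisson_pmf (theta * lambda) i.
  move=> /hB h; rewrite /poisson_pmf l0 tl0 exprMn.
  have -> : theta ^+ i = expR (i%:R * ln theta) by rewrite expRM_natl lnK ?posrE.
  set a := lambda ^+ i; set b := (i`!)%:R^-1.
  have ab0 : 0 <= a * b by rewrite mulr_ge0 ?exprn_ge0 ?invr_ge0// ltW.
  have -> : E * (expR (i%:R * ln theta) * a * b * expR (- (theta * lambda))) =
    a * b * (E * expR (i%:R * ln theta) * expR (- (theta * lambda))) by ring.
  rewrite ler_wpM2l// /E -!expRD ler_expR; lra.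
have conv : B = [set x | (fun i => i \in B) x].
  by apply/seteqP; split => x /=; [move/mem_set|move/set_mem].
rewrite /poisson_prob l0.
apply: (@le_trans _ _ (\esum_(i in B) (E%:E * (poisson_pmf (theta * lambda) i)%:E))%E).
  by apply: le_esum => i Bi; rewrite -EFinM lee_fin pw.
rewrite {1}conv -nneseries_esum; last first.
  by move=> i _; rewrite -EFinM lee_fin mulr_ge0 ?expR_ge0 ?poisson_pmf_ge0.
rewrite nneseriesZl; last by move=> i _; rewrite lee_fin poisson_pmf_ge0.
rewrite nneseries_esum; last by move=> i _; rewrite lee_fin poisson_pmf_ge0.
rewrite -conv -[leRHS]mule1; apply: lee_wpmul2l; first by rewrite lee_fin expR_ge0.
have mB : measurable B by [].
have := probability_le1 (poisson_prob (theta * lambda) k) mB.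
by rewrite /= /poisson_prob tl0; apply.
Qed.

Lemma poisson_tail kappa delta : 0 < kappa -> 0 < delta ->
  exists K B0 : R, 0 <= K /\ forall N lambda k B, B0 <= N -> 0 < N ->
  `|lambda - N / kappa| <= 1 -> (forall i, B i -> delta * N <= `|i%:R - lambda|) ->
  fine (poisson_prob lambda k B) <= K / N ^+ 2.
Proof.
move=> k0 d0; pose eta := Num.min (delta * kappa / 2) 2^-1.
have dk : 0 < delta * kappa by rewrite mulr_gt0.
have e0 : 0 < eta by rewrite lt_min divr_gt0//= invr_gt0.
have e1 : eta <= 2^-1 by rewrite ge_min lexx orbT.
have e2 : eta <= delta * kappa / 2 by rewrite ge_min lexx.
clearbody eta.
have t1 : 0 < 1 + eta by lra.
have t2 : 0 < 1 - eta by lra.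
have c1 : 0 < (1 + eta) * ln (1 + eta) - (1 + eta) + 1.
  by apply: chernoff_exponent_gt0; rewrite // -subr_eq0 addrAC subrr add0r gt_eqF.
have c2 : 0 < (1 - eta) * ln (1 - eta) - (1 - eta) + 1.
  by apply: chernoff_exponent_gt0; rewrite // -subr_eq0 addrAC subrr add0r lt_eqF//; lra.
set C1 := _ - _ + 1 in c1; set C2 := _ - _ + 1 in c2.
have [K1 K10 H1] := expRN_le_inv_sqr _ (divr_gt0 c1 (mulr_gt0 (ltr0Sn R 1) k0)).
have [K2 K20 H2] := expRN_le_inv_sqr _ (divr_gt0 c2 (mulr_gt0 (ltr0Sn R 1) k0)).
exists (K1 + K2), (2 * kappa); split; first by rewrite addr_ge0.
move=> N lambda k B NB N0 lN far.
move: lN; rewrite ler_norml => /andP[lN1 lN2].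
have Nk : 1 <= N / (2 * kappa) by rewrite ler_pdivlMr ?mulr_gt0// mul1r.
have NE : N / kappa = 2 * (N / (2 * kappa)) by field; rewrite gt_eqF.
have lge : N / (2 * kappa) <= lambda by lra.
have lle : eta * lambda <= delta * N.
  have : lambda <= 2 * (N / kappa) by lra.
  move=> /(ler_wpM2l (ltW e0))/le_trans; apply.
  have -> : eta * (2 * (N / kappa)) = eta * (2 / kappa) * N by field; rewrite gt_eqF.
  rewrite ler_pM2r// mulrA ler_pdivrMr//; lra.
have l0 : 0 < lambda by lra.
pose U := B `&` [set i | lambda <= i%:R].
pose L := B `&` ~` [set i | lambda <= i%:R].
have BE : B = U `|` L by rewrite /U /L -setIUr setUv setIT.
have h1 : (poisson_prob lambda k U <= (K1 / N ^+ 2)%:E)%E.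
  have := @poisson_chernoff lambda (1 + eta) k U l0 t1.
  move=> /(_ _)/le_trans; apply.
    move=> i [/far Bi /= li]; apply: mulr_ge0; last by rewrite ln_ge0 //; lra.
    by move: Bi; rewrite ger0_norm ?subr_ge0//; lra.
  rewrite lee_fin; apply: le_trans (H1 N N0); rewrite ler_expR lerN2 -/C1.
  have := ler_wpM2l (ltW c1) lge; lra.
have h2 : (poisson_prob lambda k L <= (K2 / N ^+ 2)%:E)%E.
  have := @poisson_chernoff lambda (1 - eta) k L l0 t2.
  move=> /(_ _)/le_trans; apply.
    move=> i [/far Bi /= /negP]; rewrite -ltNge => li.
    apply: mulr_le0; last by rewrite ln_le0//; lra.
    by move: Bi; rewrite ltr0_norm ?subr_lt0//; lra.
  rewrite lee_fin; apply: le_trans (H2 N N0); rewrite ler_expR lerN2 -/C2.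
  have := ler_wpM2l (ltW c2) lge; lra.
have h : (poisson_prob lambda k B <= ((K1 + K2) / N ^+ 2)%:E)%E.
  rewrite {1}BE; apply: (le_trans (measureU2 (poisson_prob lambda k) _ _)) => //.
  by rewrite mulrDl EFinD leeD.
rewrite -lee_fin fineK//; exact: fin_num_measure.
Qed.

End Poisson.

(** * Reduction of the Curie-Weiss model to the number of positive spins *)

Section Curie_Weiss_law.
Context {R : realType}.

Lemma sum_bool_ffun (n : nat) (phi : R -> R) :
  \sum_(b : {ffun 'I_n -> bool}) phi (\sum_(i < n) (-1) ^+ b i) =
  \sum_(0 <= j < n.+1) 'C(n, j)%:R * phi (2 * j%:R - n%:R).
Proof.
pose ff (A : {set 'I_n}) : {ffun 'I_n -> bool} := [ffun i => i \notin A].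
pose gg (b : {ffun 'I_n -> bool}) : {set 'I_n} := [set i | ~~ b i]%SET.
rewrite (reindex ff); last first.
  exists gg => [A _|b _].
    by apply/setP => i; rewrite inE ffunE negbK.
  by apply/ffunP => i; rewrite ffunE inE negbK.
have spin (A : {set 'I_n}) : \sum_(i < n) (-1) ^+ ff A i = 2 * #|A|%:R - n%:R :> R.
  have -> : #|A|%:R = \sum_(i < n) (i \in A)%:R :> R.
    by rewrite -sum1_card natr_sum big_mkcond/=; apply: eq_bigr => i _; case: ifP.
  rewrite -[X in _ - X%:R](card_ord n) -sum1_card natr_sum big_distrr/= -sumrB.
  by apply: eq_bigr => i _; rewrite ffunE; case: (i \in A); rewrite /= ?expr0 ?expr1 ?mulr1n ?mulr0n; ring.
under eq_bigr do rewrite spin.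
rewrite (partition_big (fun A : {set 'I_n} => inord #|A| : 'I_n.+1) xpredT)//=.
rewrite big_mkord; apply: eq_bigr => j _.
have cardA (A : {set 'I_n}) : (inord #|A| == j) = (#|A| == j :> nat).
  rewrite -(inj_eq val_inj)/= inordK// ltnS -[X in (_ <= X)%N](card_ord n).
  exact: max_card.
rewrite (eq_bigl (fun A => A \in [set A : {set 'I_n} | #|A| == j]%SET)); last first.
  by move=> A; rewrite inE cardA.
rewrite (eq_bigr (fun=> phi (2 * j%:R - n%:R))); last first.
  by move=> A; rewrite inE => /eqP ->.
by rewrite sumr_const card_draws card_ord [RHS]mulr_natl.
Qed.

Lemma sum_pairs_sqr (n : nat) (s : 'I_n -> R) : (forall i, s i ^+ 2 = 1) ->
  \sum_(i < n) \sum_(j < n | (i < j)%N) s i * s j =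
  ((\sum_(i < n) s i) ^+ 2 - n%:R) / 2.
Proof.
move=> s1; set P := \sum_(i < n) _.
suff -> : (\sum_(i < n) s i) ^+ 2 = 2 * P + n%:R by field.
have -> : (\sum_(i < n) s i) ^+ 2 = \sum_(i < n) \sum_(j < n) s i * s j.
  by rewrite expr2 big_distrl/=; apply: eq_bigr => i _; rewrite big_distrr.
have PE : P = \sum_(i < n) \sum_(j < n | (j < i)%N) s i * s j.
  rewrite /P; under eq_bigr do rewrite big_mkcond/=.
  rewrite exchange_big/=; apply: eq_bigr => i _; rewrite [RHS]big_mkcond/=.
  by apply: eq_bigr => j _; rewrite mulrC.
have -> : n%:R = \sum_(i < n) s i * s i.
  by under eq_bigr do rewrite -expr2 s1; rewrite sumr_const card_ord.
have -> : 2 * P = P + P by ring.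
rewrite {2}PE /P -!big_split/=; apply: eq_bigr => i _.
rewrite (bigD1 i)//= addrC; congr (_ + _).
rewrite (bigID (fun j : 'I_n => (i < j)%N))/=; congr (_ + _); apply: eq_bigl => j.
  by rewrite -(inj_eq val_inj)/=; case: ltngtP.
by rewrite -(inj_eq val_inj)/=; case: ltngtP.
Qed.

(** The right-hand side is an application to the spin sum, the shape that [sum_bool_ffun] rewrites.
    The prefactor keeps [beta / n * (n / 2)] unsimplified, so that the identity also holds at
    [n = 0], where the quotient is 0. *)
Lemma cw_weightE (beta h : R) (n : nat) (b : {ffun 'I_n -> bool}) :
  cw_weight beta h (fun i => (-1) ^+ b i) =
  (fun x => expR (- (beta / n%:R * (n%:R / 2))) *
     expR (beta / (2 * n%:R) * x ^+ 2 + h * x)) (\sum_(i < n) (-1) ^+ b i).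
Proof.
rewrite /cw_weight sum_pairs_sqr; last by move=> i; rewrite sqrr_sign.
rewrite -expRD invfM; congr expR; move: (n%:R^-1) => x; by field.
Qed.

Lemma cw_ZE (beta h : R) (n : nat) : cw_Z beta h n =
  expR (- (beta / n%:R * (n%:R / 2))) * cw_total beta h n.
Proof.
rewrite /cw_Z; under eq_bigr do rewrite cw_weightE.
rewrite (sum_bool_ffun n (fun x => _ * expR (_ * x ^+ 2 + _ * x))).
by rewrite /cw_total big_distrr/=; apply: eq_bigr => j _; rewrite /cw_pt; ring.
Qed.

Lemma sum_cw_law (beta h : R) (n : nat) (g : R -> R) :
  \sum_(b : {ffun 'I_n -> bool})
    (cw_Z beta h n)^-1 * cw_weight beta h (fun i => (-1) ^+ b i) *
       g (\sum_(i < n) (-1) ^+ b i) =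
  \sum_(0 <= j < n.+1) cw_pmf beta h n j * g (2 * j%:R - n%:R).
Proof.
under eq_bigr do rewrite cw_weightE.
rewrite (sum_bool_ffun n (fun x => _ * (_ * expR (_ * x ^+ 2 + _ * x)) * g x)).
apply: eq_bigr => j _; rewrite cw_ZE /cw_pmf /cw_pt.
by field; rewrite !gt_eqF// ?expR_gt0// cw_total_gt0.
Qed.

Section Spins.
Context {beta h : R} {n : nat} {d : measure_display} {T : measurableType d}.
Context {P : probability T R} (S : 'I_n -> {RV P >-> R}).
Context (cw : curie_weiss beta h S).

Definition spin_event (b : {ffun 'I_n -> bool}) : set T :=
  [set w | forall i, S i w = (-1) ^+ b i].

Definition spin_config (w : T) : {ffun 'I_n -> bool} := [ffun i => S i w == -1].

Lemma spin_configE w i : S i w = (-1) ^+ spin_config w i.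
Proof.
rewrite ffunE; case: (cw.1 i w) => ->; first by rewrite eqxx expr1.
by rewrite (_ : (1 == -1) = false) ?expr0// -addr_eq0 gt_eqF.
Qed.

Lemma measurable_spin_event b : measurable (spin_event b).
Proof.
have -> : spin_event b = \bigcap_(i in [set: 'I_n]) (S i @^-1` [set (-1) ^+ b i]).
  by apply/seteqP; split => w /= h1 i; [move=> _; exact: h1|exact: (h1 i I)].
apply: fin_bigcap_measurable; first exact: finite_finset.
by move=> i _; apply: measurable_funPTI.
Qed.

Lemma curie_weiss_expectation (g : R -> R) :
  'E_P[(fun w => g (\sum_(i < n) S i w))%R]%E =
  (\sum_(0 <= j < n.+1) cw_pmf beta h n j * g (2 * j%:R - n%:R))%:E.
Proof.
pose G (b : {ffun 'I_n -> bool}) : R := g (\sum_(i < n) (-1) ^+ b i).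
have gE : (fun w => g (\sum_(i < n) S i w)) =
    (fun w => \sum_(b : {ffun 'I_n -> bool}) G b * \1_(spin_event b) w).
  apply/funext => w.
  rewrite [RHS](bigD1 (spin_config w))//= [X in _ = _ + X]big1 ?addr0.
    rewrite indicE mem_set ?mulr1; last exact: spin_configE.
    by rewrite /G; congr (g _); apply: eq_bigr => i _; exact: spin_configE.
  move=> b bw; rewrite indicE memNset ?mulr0// => Eb; move/eqP: bw; apply.
  by apply/ffunP => i; have := Eb i; rewrite spin_configE => /signr_inj ->.
rewrite gE unlock.
under eq_integral do rewrite -sumEFin.
have mE := measurable_spin_event.
rewrite integral_sum//=; last first.
  move=> b; under eq_fun do rewrite EFinM.
  by apply: integrableZl => //; exact: integrable_indic.
rewrite -sum_cw_law -sumEFin; apply: eq_bigr => b _.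
under eq_integral do rewrite EFinM.
rewrite integralZl//; last exact: integrable_indic.
have PE : P (spin_event b) =
    ((cw_Z beta h n)^-1 * cw_weight beta h (fun i => (-1) ^+ b i))%:E.
  by apply: cw.2 => i; case: (b i); rewrite ?expr1 ?expr0; [left|right].
by rewrite integral_indic// setIT [X in (_ * X)%E]PE -EFinM mulrC.
Qed.

(** The set [C] is arbitrary: the spins are +1 or -1 at every point, so the event is a finite union
    of events fixing the whole configuration. *)
Lemma curie_weiss_measurable (C : set R) :
  measurable [set w | C (\sum_(i < n) S i w)].
Proof.
have -> : [set w | C (\sum_(i < n) S i w)] =
    \bigcup_(b in [set b : {ffun 'I_n -> bool} | C (\sum_(i < n) (-1) ^+ b i)]) spin_event b.
  apply/seteqP; split => w /=.
    move=> Cw; exists (spin_config w) => /=; last exact: spin_configE.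
    by under eq_bigr do rewrite -spin_configE.
  by move=> [b /= Cb Ebw]; under eq_bigr do rewrite Ebw.
apply: fin_bigcup_measurable; first exact: finite_finset.
by move=> b _; exact: measurable_spin_event.
Qed.

Lemma curie_weiss_prob (C : set R) :
  P [set w | C (\sum_(i < n) S i w)] =
  (\sum_(0 <= j < n.+1) cw_pmf beta h n j * \1_C (2 * j%:R - n%:R))%:E.
Proof.
rewrite -(curie_weiss_expectation \1_C) -expectation_indic.
  by congr expectation; apply/funext => w; rewrite !indicE.
exact: curie_weiss_measurable.
Qed.

Lemma curie_weiss_variance :
  fine 'V_P[(fun w => \sum_(i < n) S i w)%R]%E =
  \sum_(0 <= j < n.+1) cw_pmf beta h n j *
    (2 * j%:R - n%:R - \sum_(0 <= i < n.+1) cw_pmf beta h n i * (2 * i%:R - n%:R)) ^+ 2.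
Proof.
pose W w := \sum_(i < n) S i w; pose e := fine 'E_P[W].
have eE : e = \sum_(0 <= i < n.+1) cw_pmf beta h n i * (2 * i%:R - n%:R).
  by rewrite /e (curie_weiss_expectation id).
rewrite -eE -/W /variance unlock -/e.
have -> : (W \- cst e) * (W \- cst e) = (fun w => (fun x => (x - e) ^+ 2) (\sum_(i < n) S i w)).
  by apply/funext => w; rewrite /W /= expr2.
by rewrite (curie_weiss_expectation (fun x => (x - e) ^+ 2)).
Qed.

End Spins.

End Curie_Weiss_law.

(** * Local limits for the two laws *)

Section Windows.
Context {R : realType}.
Implicit Types (beta h m kappa delta lambda : R).

Lemma sqrt_nat_ge (B : R) (n : nat) : 0 <= B -> B ^+ 2 <= n%:R -> B <= @Num.sqrt R n%:R.
Proof. by move=> B0 Bn; rewrite -(ger0_norm B0) -sqrtr_sqr ler_wsqrtr. Qed.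

(** The threshold gives [delta * r >= 2] for [r = sqrt n], hence [delta * n >= 2 * r]; this leaves
    room for the rounding of the radius, which stays at least [r]. *)
Lemma window_size delta (n : nat) : 0 < delta -> 1 + (2 / delta) ^+ 2 <= n%:R ->
  [/\ 1 <= @Num.sqrt R n%:R <= (Num.truncn (delta * n%:R))%:R,
      (Num.truncn (delta * n%:R))%:R <= delta * @Num.sqrt R n%:R ^+ 2,
      delta * n%:R < (Num.truncn (delta * n%:R))%:R + 1
    & 2 <= delta * n%:R].
Proof.
move=> d0 nB; set r := @Num.sqrt R n%:R.
have d20 : 0 < 2 / delta by rewrite divr_gt0.
have sq0 : 0 <= (2 / delta) ^+ 2 by exact: sqr_ge0.
have r1 : 1 <= r by apply: sqrt_nat_ge => //; rewrite expr1n; lra.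
have r2 : 2 / delta <= r by apply: sqrt_nat_ge; [exact: ltW|lra].
have rE : r ^+ 2 = n%:R by rewrite sqr_sqrtr.
have dn0 : 0 <= delta * n%:R by rewrite mulr_ge0// ltW.
have /andP[M1 M2] := truncn_itv dn0.
rewrite -natr1 in M2; rewrite rE; split => //.
  have : 2 * r <= delta * n%:R.
    rewrite -rE expr2 mulrA ler_wpM2r//; first by lra.
    by move: r2; rewrite ler_pdivrMr// mulrC.
  by move=> ?; rewrite r1/=; lra.
have : 2 <= delta * r by move: r2; rewrite ler_pdivrMr// mulrC.
move=> H; apply: (le_trans H); rewrite ler_pM2l// -rE expr2.
by rewrite ler_peMl//; lra.
Qed.

Lemma sum_window (F : nat -> R) (a L N : nat) : (a + L <= N)%N ->
  \sum_(0 <= j < N) F j = \sum_(0 <= u < L) F (a + u)%N +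
    \sum_(0 <= j < N | ~~ (a <= j < a + L)%N) F j.
Proof.
move=> aLN; rewrite (bigID (fun j => (a <= j < a + L)%N))/=; congr (_ + _).
rewrite (@big_cat_nat _ _ _ a)//=; last by lia.
rewrite [X in _ + X](@big_cat_nat _ _ _ (a + L))//=; last by lia.
rewrite big_nat_cond big_pred0 ?add0r; last by move=> i; lia.
rewrite [X in _ + X]big_nat_cond [X in _ + X]big_pred0 ?addr0; last by move=> i; lia.
rewrite big_nat_cond (eq_bigl (fun i => (a <= i < a + L)%N && true)); last by move=> i; lia.
rewrite -big_nat_cond -{1}(add0n a) big_addn addKn.
by apply: eq_bigr => i _; rewrite addnC.
Qed.

Lemma outside_window (j0 M j : nat) : (M <= j0)%N ->
  ~~ (j0 - M <= j < j0 - M + M.*2.+1)%N -> (j + M < j0 \/ j0 + M < j)%N.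
Proof. lia. Qed.

Lemma inside_window (j0 M N u : nat) : (M <= j0)%N -> (j0 + M <= N)%N ->
  (u < M.*2.+1)%N -> (j0 - M + u <= N)%N.
Proof. lia. Qed.

Definition cw_center (m : R) (n : nat) : nat := Num.truncn (n%:R * (1 + m) / 2).

Lemma cw_centerP m (n : nat) : 0 <= m ->
  (cw_center m n)%:R <= n%:R * (1 + m) / 2 < (cw_center m n)%:R + 1.
Proof.
move=> m0; rewrite natr1; apply: truncn_itv.
by rewrite divr_ge0// mulr_ge0// addr_ge0.
Qed.

Definition gauss_density kappa r (M u : nat) : R :=
  gauss kappa r M u / gauss_mass kappa r M.

(** Stated for every small [delta], so that one radius can later serve both laws. *)
Lemma cw_window beta h m : magnetization beta h m ->
  exists2 delta0 : R, 0 < delta0 & forall delta, 0 < delta <= delta0 ->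
  exists K B : R, 0 <= K /\ forall n : nat, B <= n%:R ->
  let M := Num.truncn (delta * n%:R) in let j0 := cw_center m n in
  [/\ (M <= j0)%N, (j0 + M <= n)%N,
    forall u, (u < M.*2.+1)%N ->
      `|cw_pmf beta h n (j0 - M + u) - gauss_density (cw_kappa beta m) (@Num.sqrt R n%:R) M u|
        <= K / n%:R * decay 2 (@Num.sqrt R n%:R) M u
  & forall j, (j <= n)%N -> ~~ (j0 - M <= j < j0 - M + M.*2.+1)%N ->
      cw_pmf beta h n j <= K / n%:R ^+ 2].
Proof.
move=> mag; have k0 := cw_kappa_gt0 beta h m mag.
have [eps [C [B1 [e0 C0 loc]]]] := cw_pmf_local beta h m mag.
(* [local_limit] uses one constant for the ratio relation and for the mass missing from the window;
   the added 1 covers the latter. *)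
have C10 : 0 <= C + 1 by lra.
have [d1 [K1 [d10 K10 LL]]] := local_limit (cw_kappa beta m) (C + 1) k0 C10.
have [_ /andP[m0 m1] _ _ _] := mag.
(* The bound [(1 - m) / 4] keeps the window inside [0, n]. *)
exists (Num.min (Num.min eps d1) ((1 - m) / 4)).
  by rewrite !lt_min e0 d10 divr_gt0// subr_gt0.
move=> delta /andP[d0]; rewrite !le_min -andbA => /and3P[de dd dm].
have [K2 K20 tail] := cw_tail beta h m delta mag d0.
(* The term [(2 * K2) ^+ 2] makes the outer mass, at most [(n + 1) * K2 / n ^+ 2], smaller than
   [1 / sqrt n]. *)
exists (K1 + K2), (4 + `|B1| + (1 + (2 / delta) ^+ 2) + (2 * K2) ^+ 2).
split; first by rewrite addr_ge0.
move=> n nB M j0.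
have sq1 : 0 <= (2 / delta) ^+ 2 by exact: sqr_ge0.
have sq2 : 0 <= (2 * K2) ^+ 2 by exact: sqr_ge0.
have nB1 : B1 <= n%:R by have := ler_norm B1; lra.
have n4 : 4 <= n%:R :> R by have := normr_ge0 B1; lra.
have nd : 1 + (2 / delta) ^+ 2 <= n%:R by have := normr_ge0 B1; lra.
have nK : (2 * K2) ^+ 2 <= n%:R by have := normr_ge0 B1; lra.
have [/andP[r1 rM] Mr dM dn2] := window_size delta n d0 nd.
have /andP[j01 j02] := cw_centerP m n m0.
set r := @Num.sqrt R n%:R in r1 rM Mr *; rewrite -/M in rM Mr dM *; rewrite -/j0 in j01 j02 *.
have rE : r ^+ 2 = n%:R by rewrite sqr_sqrtr.
rewrite rE in Mr; clearbody r M j0; clear nB nd sq1 sq2.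
have n0 : 0 < n%:R :> R by lra.
have r0 : 0 < r by lra.
have n_gt0 : (0 < n)%N by rewrite -(ltr0n R).
have mn : 0 <= m * n%:R by rewrite mulr_ge0// ltW.
have dmn : delta * n%:R <= (1 - m) / 4 * n%:R by rewrite ler_pM2r.
have Mj : (M <= j0)%N by rewrite -(ler_nat R); lra.
have jMn : (j0 + M <= n)%N by rewrite -(ler_nat R) natrD; lra.
have tl j : (j <= n)%N -> ~~ (j0 - M <= j < j0 - M + M.*2.+1)%N ->
    cw_pmf beta h n j <= K2 / n%:R ^+ 2.
  move=> jn out; apply: tail => //.
  have [lo|hi] := outside_window j0 M j Mj out.
    have : j%:R + M%:R + 1 <= j0%:R :> R by rewrite -natrD natr1 ler_nat.
    by move=> ?; rewrite ler_normr; apply/orP; right; lra.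
  have : j0%:R + M%:R + 1 <= j%:R :> R by rewrite -natrD natr1 ler_nat.
  by move=> ?; rewrite ler_normr; apply/orP; left; lra.
have cE u : (j0 - M + u)%:R = j0%:R - M%:R + u%:R :> R by rewrite natrD natrB.
split => //; last first.
  move=> j jn out; apply: (le_trans (tl j jn out)).
  by rewrite ler_wpM2r ?invr_ge0 ?sqr_ge0//; lra.
move=> u uM.
have mass : `|1 - \sum_(0 <= u < M.*2.+1) cw_pmf beta h n (j0 - M + u)| <= (C + 1) / r.
  rewrite -{1}(sum_cw_pmf beta h n) (@sum_window _ (j0 - M) M.*2.+1); last first.
    by rewrite addnS ltnS; apply: inside_window.
  rewrite addrC addKr; set X := (X in `|X|).
  have X0 : 0 <= X by apply: sumr_ge0 => j _; exact: cw_pmf_ge0.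
  rewrite ger0_norm//.
  have : X <= \sum_(0 <= j < n.+1) K2 / n%:R ^+ 2.
    rewrite /X big_mkcond/=; apply: ler_sum_nat => j; rewrite ltnS => /= jn.
    case: ifP => out; first exact: tl.
    by rewrite divr_ge0 ?sqr_ge0.
  move=> /le_trans; apply; rewrite sumr_const_nat subn0 -[leLHS]mulr_natl -natr1.
  apply: (@le_trans _ _ (1 / r)); last by rewrite ler_wpM2r ?invr_ge0; lra.
  rewrite ler_pdivlMr// -rE.
  have K2r : 2 * K2 <= r.
    rewrite -(ger0_norm (ltW r0)) -[leLHS]ger0_norm ?mulr_ge0//.
    by rewrite -ler_sqr ?nnegrE// !real_normK ?num_real// rE.
  have -> : (r ^+ 2 + 1) * (K2 / (r ^+ 2) ^+ 2) * r = K2 * (r ^+ 2 + 1) / r ^+ 3.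
    by field; rewrite gt_eqF.
  rewrite ler_pdivrMr ?exprn_gt0// mul1r.
  apply: (@le_trans _ _ (K2 * (2 * r ^+ 2))).
    by rewrite ler_wpM2l// rE; lra.
  rewrite mulrCA mulrA exprS ler_wpM2r ?sqr_ge0//.
have main : `|cw_pmf beta h n (j0 - M + u) - gauss_density (cw_kappa beta m) r M u|
    <= K1 / r ^+ 2 * decay 2 r M u.
  apply: (LL r M (fun u => cw_pmf beta h n (j0 - M + u))) => //.
  - by rewrite r1.
  - by rewrite rE; apply: (le_trans Mr); rewrite ler_pM2r.
  - by move=> v vM; apply: cw_pmf_gt0; exact: inside_window.
  move=> v vM; rewrite rE.
  have E : (j0 - M + v)%:R - j0%:R = v%:R - M%:R :> R by rewrite cE; ring.
  have := loc n (j0 - M + v)%N j0 nB1; rewrite E addnS => H.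
  apply: (le_trans (H _ _ _)).
  - by rewrite -addnS; exact: inside_window.
  - by rewrite ler_norml; apply/andP; lra.
  - apply: (@le_trans _ _ (delta * n%:R)); last by rewrite ler_pM2r.
    apply: le_trans Mr; have : v%:R <= 2 * M%:R :> R by rewrite -natrM ler_nat mul2n ltnW.
    by have := ler0n R v; move=> *; rewrite ler_norml; apply/andP; lra.
  by rewrite ler_wpM2r ?addr_ge0 ?invr_ge0 ?sqr_ge0//; lra.
apply: (le_trans main); rewrite rE ler_wpM2r ?expR_ge0// ler_wpM2r ?invr_ge0; lra.
Qed.

End Windows.

(** * The same local limit for the Poisson law *)

Section Poisson_window.
Context {R : realType}.
Implicit Types (kappa delta lambda : R).

Lemma fine_measure_window (mu : probability nat R) (B : set nat) (a L : nat) :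
  fine (mu B) = \sum_(0 <= u < L) fine (mu [set (a + u)%N]) * \1_B (a + u)%N
    + fine (mu (B `&` [set i | ~~ (a <= i < a + L)%N])).
Proof.
have mT (C : set nat) : measurable C by [].
have fin (C : set nat) : mu C \is a fin_num by exact: fin_num_measure.
elim: L => [|L IH].
  rewrite big_geq// add0r; congr (fine (mu _)); apply/seteqP; split => i /=; last by case.
  by move=> Bi; split => //; lia.
rewrite IH big_nat_recr//= -addrA; congr (_ + _).
have -> : B `&` [set i | ~~ (a <= i < a + L)%N] =
    (B `&` [set (a + L)%N]) `|` (B `&` [set i | ~~ (a <= i < a + L.+1)%N]).
  apply/seteqP; split => i /=.
    move=> [Bi ih]; case: (eqVneq i (a + L)%N) => iE; [by left|right].
    by split; [exact: Bi|move: iE ih; lia].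
  by move=> [[Bi ie]|[Bi ih]]; (split; first exact: Bi); [rewrite ie; lia|move: ih; lia].
have d0 : (B `&` [set (a + L)%N]) `&` (B `&` [set i | ~~ (a <= i < a + L.+1)%N]) = set0.
  by apply/seteqP; split => i //= [[_ ->] [_]]; lia.
rewrite measureU// fineD; try exact: fin_num_measure.
congr (_ + _).
rewrite indicE; have [aB|aB] := boolP ((a + L)%N \in B).
  by rewrite mulr1; congr (fine (mu _)); apply/setIidPr => i ->; exact: set_mem.
rewrite mulr0 (_ : _ `&` _ = set0) ?measure0//.
by apply/seteqP; split => i //= [Bi ie]; move: aB; rewrite -ie mem_set.
Qed.

Lemma gauss_density_le kappa : 0 < kappa -> exists2 K : R, 0 <= K &
  forall r (M u : nat), 1 <= r <= M%:R ->
    gauss_density kappa r M u <= K / r * decay 2 r M u.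
Proof.
move=> k0; have [K K0 gd] := gauss_le_decay kappa k0.
have c0 : 0 < expR (- (kappa / 2)) by exact: expR_gt0.
exists (K / expR (- (kappa / 2))); first by rewrite divr_ge0// ltW.
move=> r M u rM; have := gauss_mass_ge kappa r M (ltW k0) rM.
have r0 : 0 < r by have /andP[r1 _] := rM; lra.
have cr : 0 < expR (- (kappa / 2)) * r by rewrite mulr_gt0.
move=> mg; rewrite /gauss_density.
have -> : K / expR (- (kappa / 2)) / r * decay 2 r M u =
  K * decay 2 r M u / (expR (- (kappa / 2)) * r) by field; rewrite !gt_eqF.
apply: ler_pM => //; first exact: expR_ge0.
  by rewrite invr_ge0 ltW// (lt_le_trans cr).
by rewrite lef_pV2 ?posrE// (lt_le_trans cr).
Qed.

(** The centre [i0] is any integer within 1 of the mean; this freedom allows it to be dictated by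
    the Curie-Weiss centre. *)
Lemma poisson_window kappa : 0 < kappa ->
  exists2 delta0 : R, 0 < delta0 & forall delta, 0 < delta <= delta0 ->
  exists K B : R, 0 <= K /\ forall (n i0 : nat) lambda, B <= n%:R ->
  `|lambda - n%:R / kappa| <= 1 -> `|i0%:R - lambda| <= 1 ->
  let M := Num.truncn (delta * n%:R) in
  [/\ (M <= i0)%N, 0 < lambda,
    forall u, (u < M.*2.+1)%N ->
      `|poisson_pmf lambda (i0 - M + u) - gauss_density kappa (@Num.sqrt R n%:R) M u|
        <= K / n%:R * decay 2 (@Num.sqrt R n%:R) M u
  & forall (k : nat) (B : set nat), (forall i, B i -> ~~ (i0 - M <= i < i0 - M + M.*2.+1)%N) ->
      fine (poisson_prob lambda k B) <= K / n%:R ^+ 2].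
Proof.
move=> k0.
have [eps [C [B1 [e0 C0 loc]]]] := poisson_pmf_local kappa k0.
have C10 : 0 <= C + 1 by lra.
have [d1 [K1 [d10 K10 LL]]] := local_limit kappa (C + 1) k0 C10.
exists (Num.min (Num.min eps d1) (2 * kappa)^-1).
  by rewrite !lt_min e0 d10 invr_gt0 mulr_gt0.
move=> delta /andP[d0]; rewrite !le_min -andbA => /and3P[de dd dk].
have d20 : 0 < delta / 2 by lra.
(* Half of [delta] is given up because the tail is measured from [lambda] while the window is
   centred at [i0]; the loss of 1 is at most [delta * n / 2]. *)
have [K2 [B2 [K20 tail]]] := poisson_tail kappa (delta / 2) k0 d20.
exists (K1 + K2), (1 + 4 * kappa + `|B1| + `|B2| + (1 + (2 / delta) ^+ 2) + K2).
split; first by rewrite addr_ge0.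
move=> n i0 lambda nB lN il M.
have [nB1 [nB2 [nd [nK nk]]]] : B1 <= n%:R /\ B2 <= n%:R /\
    1 + (2 / delta) ^+ 2 <= n%:R /\ K2 <= n%:R /\ 1 + 4 * kappa <= n%:R.
  have := ler_norm B1; have := ler_norm B2; have := normr_ge0 B1; have := normr_ge0 B2.
  have := sqr_ge0 (2 / delta); move: nB K20 k0; clear; move: (`|B1|) (`|B2|) (_ ^+ 2) => *.
  by do !split; lra.
clear nB; have [/andP[r1 rM] Mr dM dn2] := window_size delta n d0 nd.
set r := @Num.sqrt R n%:R in r1 rM Mr *; rewrite -/M in rM Mr dM *.
have rE : r ^+ 2 = n%:R by rewrite sqr_sqrtr.
rewrite rE in Mr; clearbody r M; clear nd.
have n0 : 0 < n%:R :> R by lra.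
have r0 : 0 < r by lra.
have lge : n%:R / (2 * kappa) + 1 <= lambda.
  have : n%:R / kappa = n%:R / (2 * kappa) + n%:R / (2 * kappa) by field; rewrite gt_eqF.
  have : 2 <= n%:R / (2 * kappa) by rewrite ler_pdivlMr ?mulr_gt0//; lra.
  by move: lN; rewrite ler_norml => /andP[? _] ? ?; lra.
have dn : delta * n%:R <= n%:R / (2 * kappa) by rewrite mulrC ler_pM2l.
have l0 : 0 < lambda by lra.
have Mi : (M <= i0)%N.
  by rewrite -(ler_nat R); move: il; rewrite ler_norml => /andP[? _]; lra.
have tl k (B : set nat) : (forall i, B i -> ~~ (i0 - M <= i < i0 - M + M.*2.+1)%N) ->
    fine (poisson_prob lambda k B) <= K2 / n%:R ^+ 2.
  move=> out; apply: tail => // i Bi.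
  move: il; rewrite ler_norml => /andP[il1 il2].
  have [lo|hi] := outside_window i0 M i Mi (out i Bi).
    have : i%:R + M%:R + 1 <= i0%:R :> R by rewrite -natrD natr1 ler_nat.
    by move=> ?; rewrite ler_normr; apply/orP; right; lra.
  have : i0%:R + M%:R + 1 <= i%:R :> R by rewrite -natrD natr1 ler_nat.
  by move=> ?; rewrite ler_normr; apply/orP; left; lra.
have cE u : (i0 - M + u)%:R = i0%:R - M%:R + u%:R :> R by rewrite natrD natrB.
have inv0 : 0 <= (n%:R ^+ 2)^-1 :> R by rewrite invr_ge0 sqr_ge0.
split => //; last first.
  move=> k B out; apply: (le_trans (tl k B out)).
  by rewrite ler_wpM2r// lerDr.
move=> u uM.
have mass : `|1 - \sum_(0 <= u < M.*2.+1) poisson_pmf lambda (i0 - M + u)| <= (C + 1) / r.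
  have := fine_measure_window (poisson_prob lambda 0%N : probability _ R) setT (i0 - M) M.*2.+1.
  rewrite probability_setT/= => {1}->.
  under eq_bigr do rewrite poisson_prob1//= indicE in_setT mulr1.
  rewrite addrAC subrr add0r setTI ger0_norm ?fine_ge0 ?measure_ge0//.
  apply: (le_trans (tl 0%N _ _)) => //.
  have : K2 / n%:R ^+ 2 <= 1 / n%:R.
    by rewrite ler_pdivrMr ?exprn_gt0// expr2 mulrA mul1r mulVf ?gt_eqF// mul1r.
  move=> /le_trans; apply; rewrite -rE.
  apply: ler_pM; rewrite ?invr_ge0 ?(ltW r0) ?sqr_ge0// ?lerDr//.
  by rewrite lef_pV2 ?posrE ?exprn_gt0// expr2 ler_peMl// ltW.
have main : `|poisson_pmf lambda (i0 - M + u) - gauss_density kappa r M u|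
    <= K1 / r ^+ 2 * decay 2 r M u.
  apply: (LL r M (fun u => poisson_pmf lambda (i0 - M + u))) => //.
  - by rewrite r1.
  - by rewrite rE; apply: (le_trans Mr); rewrite ler_pM2r.
  - by move=> v vM; exact: poisson_pmf_gt0.
  move=> v vM; rewrite rE.
  have E : (i0 - M + v)%:R - i0%:R = v%:R - M%:R :> R by rewrite cE; ring.
  have := loc n%:R lambda (i0 - M + v)%N i0 nB1 n0 lN il; rewrite E addnS => H.
  apply: (le_trans (H _)).
  - apply: (@le_trans _ _ (delta * n%:R)); last by rewrite ler_pM2r.
    apply: le_trans Mr; have : v%:R <= 2 * M%:R :> R by rewrite -natrM ler_nat mul2n ltnW.
    have := ler0n R v; clear; move=> *; rewrite ler_norml; apply/andP; lra.
  by rewrite ler_wpM2r ?addr_ge0 ?invr_ge0 ?sqr_ge0// lerDl.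
apply: (le_trans main); rewrite rE ler_wpM2r ?expR_ge0// ler_wpM2r ?invr_ge0 ?(ltW n0)//.
by rewrite lerDl.
Qed.

End Poisson_window.

(** * The variance *)

Section Variance_bounds.
Context {R : realType}.
Implicit Types (beta h m : R).

Lemma sum_interval_le (lo hi : R) (N : nat) : lo <= hi ->
  \sum_(0 <= j < N) (lo < j%:R < hi)%R%:R <= hi - lo + 1.
Proof.
move=> lh.
(* The second bound strengthens the induction: when [N] lies in the interval, it gives at most
   [N - lo + 1] points so far, and [N < hi]. *)
suff /andP[] : (\sum_(0 <= j < N) (lo < j%:R < hi)%R%:R <= hi - lo + 1) &&
  (\sum_(0 <= j < N) (lo < j%:R < hi)%R%:R <= Num.max 0 (N%:R - lo)) by [].
elim: N => [|N /andP[IH1 IH2]].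
  by rewrite big_geq// le_max lexx andbT; lra.
rewrite big_nat_recr//= -natr1.
case: (boolP (lo < N%:R < hi)) => [/andP[h1 h2]|_]; last first.
  rewrite addr0 IH1/=; apply: (le_trans IH2).
  by rewrite ge_max !le_max lexx/=; apply/orP; right; lra.
move: IH2; rewrite max_r ?subr_ge0 ?(ltW h1)// => IH2.
by apply/andP; split; [|rewrite le_max; apply/orP; right]; rewrite /=; lra.
Qed.

Lemma variance_le_second_moment (p x : nat -> R) (N : nat) (a : R) :
  \sum_(0 <= j < N) p j = 1 ->
  \sum_(0 <= j < N) p j * (x j - \sum_(0 <= i < N) p i * x i) ^+ 2
    <= \sum_(0 <= j < N) p j * (x j - a) ^+ 2.
Proof.
move=> p1; set e := \sum_(0 <= i < N) p i * x i.
have -> : \sum_(0 <= j < N) p j * (x j - a) ^+ 2 =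
  \sum_(0 <= j < N) p j * (x j - e) ^+ 2 +
  \sum_(0 <= j < N) (2 * (e - a) * (p j * x j - e * p j) + (e - a) ^+ 2 * p j).
  by rewrite -big_split/=; apply: eq_bigr => j _; ring.
rewrite lerDl big_split/= -!big_distrr/= sumrB -big_distrr/= p1 -/e !mulr1.
by rewrite subrr mulr0 add0r sqr_ge0.
Qed.

Lemma cw_pmf_upper beta h m : magnetization beta h m ->
  exists delta K B : R, [/\ 0 < delta, 1 <= K & forall n : nat, B <= n%:R ->
  let M := Num.truncn (delta * n%:R) in let j0 := cw_center m n in
  [/\ (M <= j0)%N, (j0 + M <= n)%N, 1 <= n%:R :> R,
    forall u, (u < M.*2.+1)%N -> cw_pmf beta h n (j0 - M + u) <=
       K / @Num.sqrt R n%:R * decay 2 (@Num.sqrt R n%:R) M u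
  & forall j, (j <= n)%N -> ~~ (j0 - M <= j < j0 - M + M.*2.+1)%N ->
      cw_pmf beta h n j <= K / n%:R ^+ 2]].
Proof.
move=> mag; have [d0 d00 W] := cw_window beta h m mag.
have [|K1 [B1 [K10 {}W]]] := W d0; first by rewrite d00 lexx.
have [K2 K20 gd] := gauss_density_le (cw_kappa beta m) (cw_kappa_gt0 beta h m mag).
exists d0, (1 + K1 + K2), (`|B1| + (1 + (2 / d0) ^+ 2)); split => //.
  by rewrite -addrA lerDl addr_ge0.
move=> n nB M j0.
have nB1 : B1 <= n%:R.
  by have := ler_norm B1; have := sqr_ge0 (2 / d0); move: nB; clear; lra.
have nd : 1 + (2 / d0) ^+ 2 <= n%:R by have := normr_ge0 B1; move: nB; clear; lra.
have n1 : 1 <= n%:R :> R by have := sqr_ge0 (2 / d0); move: nd; clear; lra.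
have [Mj jM w1 w2] := W n nB1.
have [rM _ _ _] := window_size d0 n d00 nd.
set r := @Num.sqrt R n%:R in rM w1 *.
have rE : r ^+ 2 = n%:R by rewrite sqr_sqrtr.
have /andP[r1 _] := rM; have r0 : 0 < r by exact: lt_le_trans r1.
rewrite -/M -/j0 in Mj jM w1 w2 rM *; split => //.
- move=> u uM; have := w1 u uM.
  set e := decay _ _ _ _; have e0 : 0 <= e by exact: expR_ge0.
  have := gd r M u rM; rewrite -/e.
  move=> g; rewrite ler_norml => /andP[_ w].
  have : K1 / n%:R * e <= K1 / r * e.
    rewrite ler_wpM2r// ler_wpM2l// -rE lef_pV2 ?posrE ?exprn_gt0//.
    by rewrite expr2 ler_peMl// ltW.
  have : 0 <= r^-1 * e by rewrite mulr_ge0 ?invr_ge0 ?(ltW r0).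
  have -> : (1 + K1 + K2) / r * e = r^-1 * e + K1 / r * e + K2 / r * e by ring.
  by move: w g; clear; lra.
- move=> j jn out; apply: (le_trans (w2 j jn out)).
  by rewrite ler_wpM2r ?invr_ge0 ?sqr_ge0//; move: K20; clear; lra.
Qed.

(** Only the order of magnitude is at stake, so the mean is never located. The upper bound uses the
    second moment about the centre in its place; the lower bound holds because atoms of size
    [O(1 / r)] cannot concentrate on an interval much shorter than [r], wherever it lies. *)
Lemma cw_variance_bounds beta h m : magnetization beta h m ->
  exists c K B : R, [/\ 0 < c, 0 < K & forall n : nat, B <= n%:R ->
  c * n%:R <= \sum_(0 <= j < n.+1) cw_pmf beta h n j *
     (2 * j%:R - n%:R - \sum_(0 <= i < n.+1) cw_pmf beta h n i * (2 * i%:R - n%:R)) ^+ 2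
  <= K * n%:R].
Proof.
move=> mag; have [delta [K [B [d0 K1 W]]]] := cw_pmf_upper beta h m mag.
have K0 : 0 < K by lra.
(* The lower constant is [T ^+ 2 / (2 * n)] with [T = r / (4 * K)]; in the upper one [64 * K] comes
   from the window and [8 * K] from its complement. The threshold gives [K / r <= 4^-1]. *)
exists ((32 * K ^+ 2)^-1), (72 * K), (`|B| + (4 * K) ^+ 2); split.
- by rewrite invr_gt0 mulr_gt0 ?exprn_gt0.
- by rewrite mulr_gt0.
move=> n nB; have nB' : B <= n%:R.
  by have := ler_norm B; have := sqr_ge0 (4 * K); move: nB; clear; lra.
have nK : (4 * K) ^+ 2 <= n%:R by have := normr_ge0 B; move: nB; clear; lra.
have := W n nB'; set M := Num.truncn _; set j0 := cw_center m n; clearbody M j0.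
move=> [Mj jM n1 win out].
set r := @Num.sqrt R n%:R in win *.
have rE : r ^+ 2 = n%:R by rewrite sqr_sqrtr.
have rK : 4 * K <= r by apply: sqrt_nat_ge; [rewrite mulr_ge0// ltW|exact: nK].
have r1 : 1 <= r by apply: sqrt_nat_ge; rewrite // expr1n.
clearbody r; clear nB nB' nK W.
have r0 : 0 < r by lra.
have n0 : 0 < n%:R :> R by lra.
apply/andP; split; last first.
  apply: le_trans (variance_le_second_moment _ (fun j => 2 * j%:R - n%:R) n.+1
    (2 * j0%:R - n%:R) (sum_cw_pmf beta h n)) _.
  have aLN : (j0 - M + M.*2.+1 <= n.+1)%N.
    by rewrite addnS ltnS; apply: inside_window.
  rewrite (@sum_window _ _ (j0 - M) M.*2.+1)//.
  have -> : 72 * K * n%:R = 64 * K * n%:R + 8 * K * n%:R by ring.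
  apply: lerD.
    apply: (@le_trans _ _ (\sum_(0 <= u < M.*2.+1) (16 * K * r) * decay 1 r M u)).
      apply: ler_sum_nat => u /andP[_ uM].
      have -> : 2 * (j0 - M + u)%:R - n%:R - (2 * j0%:R - n%:R) = 2 * (u%:R - M%:R) :> R.
        by rewrite natrD natrB//; ring.
      apply: (@le_trans _ _ (K / r * decay 2 r M u * (2 * (u%:R - M%:R)) ^+ 2)).
        by rewrite ler_wpM2r ?sqr_ge0// win.
      have -> : (2 * (u%:R - M%:R)) ^+ 2 = 4 * r ^+ 2 * (`|u%:R - M%:R| / r) ^+ 2 :> R.
        by rewrite !exprMn real_normK ?num_real//; field; rewrite gt_eqF.
      rewrite /decay; set x := `|_| / r; rewrite mul1r.
      have x0 : 0 <= x by rewrite divr_ge0// ltW.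
      have := expr_le_expR x 1 x0 => xe.
      (* One half of the decay absorbs [x ^+ 2 <= 4 * expR x], the other half remains summable. *)
      have -> : - (2 * x) = - x - x by ring.
      rewrite expRD.
      have -> : K / r * (expR (- x) * expR (- x)) * (4 * r ^+ 2 * x ^+ 2) =
        4 * K * r * expR (- x) * (expR (- x) * x ^+ 2) by field; rewrite gt_eqF.
      have -> : 16 * K * r * expR (- x) = 4 * K * r * expR (- x) * 4 by ring.
      apply: ler_wpM2l; first by rewrite !mulr_ge0 ?expR_ge0// ltW.
      by rewrite expRN mulrC ler_pdivrMr ?expR_gt0//; move: xe; clear; lra.
    rewrite -big_distrr/=.
    have Kr : 0 <= 16 * K * r by rewrite !mulr_ge0// ltW.
    apply: (le_trans (ler_wpM2l Kr (sum_decay_le 1 r M ltr01 r0))).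
    have h1 : 2 * (1 + r / 1) <= 4 * r by move: r1; clear; lra.
    apply: (le_trans (ler_wpM2l Kr h1)); rewrite -rE.
    by rewrite le_eqVlt; apply/orP; left; apply/eqP; ring.
  apply: (@le_trans _ _ (\sum_(0 <= j < n.+1) 4 * K)).
    rewrite big_mkcond/=; apply: ler_sum_nat => j; rewrite ltnS => /= jn.
    case: ifP => o; last by rewrite mulr_ge0// ltW.
    have -> : 4 * K = K / n%:R ^+ 2 * (2 * n%:R) ^+ 2 by field; rewrite gt_eqF.
    apply: ler_pM => //; rewrite ?cw_pmf_ge0 ?sqr_ge0//; first exact: out.
    rewrite -[leLHS]real_normK ?num_real// lerXn2r ?nnegrE ?mulr_ge0//.
    have -> : 2 * j%:R - n%:R - (2 * j0%:R - n%:R) = 2 * (j%:R - j0%:R) :> R by ring.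
    rewrite normrM ger0_norm// ler_wpM2l// ler_norml.
    have : j%:R <= n%:R :> R by rewrite ler_nat.
    have : j0%:R <= n%:R :> R by rewrite ler_nat (leq_trans _ jM)// leq_addr.
    have := ler0n R j; have := ler0n R j0; clear; move=> *; apply/andP; lra.
  rewrite sumr_const_nat subn0 -[leLHS]mulr_natr -natr1.
  have := ler_wpM2l (ltW K0) n1; clear; lra.
set e := \sum_(0 <= i < n.+1) cw_pmf beta h n i * (2 * i%:R - n%:R).
(* Every atom is at most K / r, so less than half of the mass is within T of the mean. *)
pose T := r / (4 * K).
have T0 : 0 < T by rewrite divr_gt0// mulr_gt0.
have ub j : (j <= n)%N -> cw_pmf beta h n j <= K / r.
  move=> jn; case: (boolP (j0 - M <= j < j0 - M + M.*2.+1)%N) => [/andP[j1 j2]|o].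
    have uM : (j - (j0 - M) < M.*2.+1)%N by rewrite ltn_subLR.
    have := win _ uM; rewrite subnKC// => /le_trans; apply.
    rewrite ler_piMr//; first by rewrite divr_ge0 ?ltW.
    by rewrite /decay expR_le1 oppr_le0 !mulr_ge0 ?invr_ge0 ?(ltW r0).
  apply: (le_trans (out j jn o)); rewrite ler_wpM2l ?(ltW K0)// lef_pV2 ?posrE ?exprn_gt0//.
  by rewrite -rE -exprM ler_eXnr.
have near_le : \sum_(0 <= j < n.+1) cw_pmf beta h n j *
    ((n%:R + e - T) / 2 < j%:R < (n%:R + e + T) / 2)%R%:R <= 2^-1.
  apply: (@le_trans _ _ (\sum_(0 <= j < n.+1) K / r *
    ((n%:R + e - T) / 2 < j%:R < (n%:R + e + T) / 2)%R%:R)).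
    by apply: ler_sum_nat => j; rewrite ltnS => /= jn; rewrite ler_wpM2r// ub.
  rewrite -big_distrr/=.
  have Kr : 0 <= K / r by rewrite divr_ge0 ?ltW.
  have lh : (n%:R + e - T) / 2 <= (n%:R + e + T) / 2 by move: T0; clear; lra.
  apply: (le_trans (ler_wpM2l Kr (sum_interval_le _ _ n.+1 lh))).
  have -> : K / r * ((n%:R + e + T) / 2 - (n%:R + e - T) / 2 + 1) = 4^-1 + K / r.
    by rewrite /T; field; rewrite !gt_eqF.
  have : K / r <= 4^-1 by rewrite ler_pdivrMr//; move: rK; clear; lra.
  by clear; lra.
apply: (@le_trans _ _ (\sum_(0 <= j < n.+1) (T ^+ 2 * cw_pmf beta h n j - T ^+ 2 *
   (cw_pmf beta h n j * ((n%:R + e - T) / 2 < j%:R < (n%:R + e + T) / 2)%R%:R)))).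
  rewrite sumrB -!big_distrr/= sum_cw_pmf.
  have T2 : 0 <= T ^+ 2 by exact: sqr_ge0.
  have := ler_wpM2l T2 near_le.
  have -> : (32 * K ^+ 2)^-1 * n%:R = T ^+ 2 / 2 by rewrite /T -rE; field; rewrite gt_eqF.
  move=> H; apply: le_trans (lerB (lexx _) H).
  by rewrite le_eqVlt; apply/orP; left; apply/eqP; field.
apply: ler_sum_nat => j _; set p := cw_pmf _ _ _ _.
have p0 : 0 <= p by exact: cw_pmf_ge0.
case: (boolP (_ < j%:R < _)) => [_|].
  by rewrite mulr1 subrr mulr_ge0// sqr_ge0.
rewrite mulr0 mulr0 subr0 negb_and -!leNgt => far.
rewrite mulrC ler_wpM2l// -[leRHS]real_normK ?num_real// lerXn2r ?nnegrE// ?(ltW T0)//.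
rewrite ler_normr; case/orP: far => f; apply/orP; [right|left]; move: f; clear.
all: lra.
Qed.

End Variance_bounds.

(** * Comparison of the two laws *)

Section Closeness.
Context {R : realType}.
Implicit Types (beta h m lambda : R).

Lemma sum_indic_set1_le1 (c a : int) (L : nat) :
  \sum_(0 <= u < L) (\1_[set a] (c + u%:Z) : R) <= 1.
Proof.
have uniq u v : c + u%:Z = a -> c + v%:Z = a -> u = v.
  by move=> <- /addrI [].
elim: L => [|L IH]; first by rewrite big_geq.
rewrite big_nat_recr//= indicE; have [aL|aL] := boolP (c + L%:Z \in [set a]).
  rewrite big_nat big1 ?add0r// => u /andP[_ uL].
  rewrite indicE memNset// => cu; move: aL => /set_mem/= cL.
  by have := uniq _ _ cu cL; move: uL => /[swap] ->; rewrite ltnn.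
by rewrite addr0.
Qed.

Lemma indic_ge0_le1 (T : Type) (A : set T) (x : T) : 0 <= (\1_A x : R) <= 1.
Proof. by rewrite indicE; case: (x \in A); rewrite ?lexx ?ler01. Qed.

Lemma window_index (s : int) (j0 i0 M k u : nat) : (M <= j0)%N -> (M <= i0)%N ->
  i0%:Z = j0%:Z - k%:Z - s ->
  (j0 - M + u)%:Z - k%:Z = s + (i0 - M + u)%:Z.
Proof. lia. Qed.

(** Inside the windows the two laws differ by [O(1 / n)] times the decay factor, weighted by the
    indicator of [A]. For general [A] the decay factors sum to [O(sqrt n)], whereas a singleton
    selects at most one of them: hence the two rates. The complements of the windows contribute
    [O(1 / n)] in either case. *)
Lemma cw_poisson_close beta h m : magnetization beta h m ->
  exists K B : R, 0 <= K /\ forall (n : nat) (s : int) lambda, B <= n%:R ->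
  `|lambda - n%:R / cw_kappa beta m| <= 1 -> lambda + s%:~R = n%:R * m / 2 ->
  0 < lambda /\ forall A : set int,
  let D := `|\sum_(0 <= j < n.+1) cw_pmf beta h n j * \1_A (j%:Z - (n./2)%:Z)
     - fine (poisson_prob lambda 0%N [set i : nat | A (s + i%:Z)])| in
  D <= K / @Num.sqrt R n%:R /\ (forall a, A = [set a] -> D <= K / n%:R).
Proof.
move=> mag; have k0 := cw_kappa_gt0 beta h m mag.
have [d1 d10 W1] := cw_window beta h m mag.
have [d2 d20 W2] := poisson_window _ k0.
pose delta := Num.min d1 d2.
have d0 : 0 < delta by rewrite lt_min d10.
have [|K1 [B1 [K10 {}W1]]] := W1 delta; first by rewrite d0 ge_min lexx.
have [|K2 [B2 [K20 {}W2]]] := W2 delta; first by rewrite d0 ge_min lexx orbT.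
set kappa := cw_kappa beta m in k0 W1 W2 *.
exists (10 * (K1 + K2)), (1 + 2 * kappa + `|B1| + `|B2|); split.
  by rewrite mulr_ge0 ?addr_ge0.
move=> n s lambda nB lN lE.
have [nB1 [nB2 [n1 nk]]] : B1 <= n%:R /\ B2 <= n%:R /\ 1 <= n%:R :> R /\ 2 * kappa <= n%:R.
  have := ler_norm B1; have := ler_norm B2; have := normr_ge0 B1; have := normr_ge0 B2.
  by move: nB k0; clear; move: (`|B1|) (`|B2|) => *; do !split; lra.
have [_ /andP[m0 m1] _ _ _] := mag.
have [Mj jM w1 o1] := W1 n nB1.
have /andP[j01 j02] := cw_centerP m n m0.
have n2 : n%:R = (odd n)%:R + 2 * (n./2)%:R :> R.
  by rewrite -{1}(odd_double_half n) natrD -mul2n natrM.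
have o01 : 0 <= (odd n)%:R :> R /\ (odd n)%:R <= 1 :> R by rewrite lern1 leq_b1.
(* The image of the Curie-Weiss centre on the Poisson side. It differs from [lambda] by the rounding
   of the centre, in (-1, 0], plus half the parity of [n], hence by at most 1. *)
pose z : int := (cw_center m n)%:Z - (n./2)%:Z - s.
have zE : z%:~R = (cw_center m n)%:R - (n./2)%:R - s%:~R :> R by rewrite /z !rmorphB/= -!pmulrn.
have zl : `|z%:~R - lambda| <= 1.
  rewrite zE ler_norml; move: j01 j02 n2 o01 lE; clear.
  move: (odd n)%:R => o; move=> ? ? ? [? ?] ?.
  by apply/andP; split; lra.
have l1 : 1 <= lambda.
  have : 2 <= n%:R / kappa by rewrite ler_pdivlMr.
  by move: lN; rewrite ler_norml => /andP[+ _]; clear; lra.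
have z0 : 0 <= z.
  by rewrite -(ler0z R); move: zl l1; rewrite ler_norml => /andP[+ _]; clear; lra.
pose i0 := `|z|%N.
have i0z : i0%:Z = z by rewrite /i0 gez0_abs.
have il : `|i0%:R - lambda| <= 1 by rewrite -[i0%:R]/(i0%:Z%:~R) i0z.
have [Mi l0 w2 o2] := W2 n i0 lambda nB2 lN il.
split => //; clear W1 W2.
move: Mj jM w1 o1 Mi w2 o2; set M := Num.truncn _; set j0 := cw_center m n.
set r := @Num.sqrt R n%:R; move=> Mj jM w1 o1 Mi w2 o2.
have i0E : i0%:Z = j0%:Z - (n./2)%:Z - s by rewrite i0z.
have rE : r ^+ 2 = n%:R by rewrite sqr_sqrtr.
have r1 : 1 <= r by apply: sqrt_nat_ge; rewrite // expr1n.
have r0 : 0 < r by exact: lt_le_trans r1.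
clearbody M j0 r i0; clear zE zl z0 i0z z j01 j02.
move=> A; set B := [set i : nat | A (s + i%:Z)].
pose c : int := s + (i0 - M)%:Z.
have cu u : s + (i0 - M + u)%:Z = c + u%:Z by rewrite /c -addrA -PoszD.
have n0 : 0 < n%:R :> R by exact: lt_le_trans n1.
have main : `|\sum_(0 <= j < n.+1) cw_pmf beta h n j * \1_A (j%:Z - (n./2)%:Z)
     - fine (poisson_prob lambda 0%N B)| <=
   (K1 + K2) / n%:R * \sum_(0 <= u < M.*2.+1) decay 2 r M u * \1_A (c + u%:Z)
   + 2 * (K1 + K2) / n%:R.
  have aLN : (j0 - M + M.*2.+1 <= n.+1)%N.
    by rewrite addnS ltnS; apply: inside_window.
  rewrite (@sum_window _ _ (j0 - M) M.*2.+1)//.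
  rewrite (fine_measure_window (poisson_prob lambda 0%N : probability _ R) B (i0 - M) M.*2.+1).
  set X := \sum_(0 <= j < n.+1 | ~~ (j0 - M <= j < j0 - M + M.*2.+1)%N) _; set Y := fine (_ (B `&` _)).
  rewrite opprD addrACA -sumrB; apply: (le_trans (ler_normD _ _)); apply: lerD.
    rewrite big_distrr/=; apply: (le_trans (ler_norm_sum _ _ _)).
    apply: ler_sum_nat => u /andP[_ uM].
    rewrite (window_index s j0 i0 M _ u Mj Mi i0E) /= poisson_prob1//=.
    have -> : \1_B (i0 - M + u)%N = \1_A (c + u%:Z) :> R.
      by rewrite !indicE -cu; congr (_%:R); apply/idP/idP => /set_mem ?; exact: mem_set.
    rewrite cu; have /andP[i1 i2] := indic_ge0_le1 _ A (c + u%:Z).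
    rewrite -mulrBl normrM (ger0_norm i1) mulrA ler_wpM2r//.
    have := w1 u uM; have := w2 u uM.
    move: (gauss_density _ _ _ _) => g h2 h1.
    have := ler_normB (cw_pmf beta h n (j0 - M + u) - g) (poisson_pmf lambda (i0 - M + u) - g).
    rewrite opprB addrA subrK => /le_trans; apply.
    by rewrite 2!mulrDl; apply: lerD.
  have X0 : 0 <= X.
    by apply: sumr_ge0 => j _; rewrite mulr_ge0 ?cw_pmf_ge0//;
      case/andP: (indic_ge0_le1 _ A (j%:Z - (n./2)%:Z)).
  have Y0 : 0 <= Y by rewrite fine_ge0// measure_ge0.
  have nn : (n%:R + 1) / n%:R ^+ 2 <= 2 / n%:R :> R.
    rewrite ler_pdivrMr ?exprn_gt0//.
    have -> : 2 / n%:R * n%:R ^+ 2 = 2 * n%:R :> R by field; rewrite gt_eqF.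
    by move: n1; clear; lra.
  have XK : X <= 2 * K1 / n%:R.
    apply: (@le_trans _ _ (\sum_(0 <= j < n.+1) K1 / n%:R ^+ 2)).
      rewrite /X big_mkcond/=; apply: ler_sum_nat => j; rewrite ltnS => /= jn.
      case: ifP => o; last by rewrite divr_ge0 ?sqr_ge0.
      apply: le_trans (o1 j jn o); rewrite ler_piMr ?cw_pmf_ge0//.
    rewrite sumr_const_nat subn0 -[leLHS]mulr_natl -natr1.
    have := ler_wpM2l K10 nn.
    have -> : K1 * ((n%:R + 1) / n%:R ^+ 2) = (n%:R + 1) * (K1 / n%:R ^+ 2) by ring.
    by have -> : K1 * (2 / n%:R) = 2 * K1 / n%:R by ring.
  have YK : Y <= K2 / n%:R.
    apply: (le_trans (o2 0%N (B `&` _) _)); first by move=> i [].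
    by rewrite ler_wpM2l// lef_pV2 ?posrE ?exprn_gt0// ler_eXnr.
  have K2n : 0 <= K2 / n%:R by rewrite divr_ge0// ltW.
  have -> : 2 * (K1 + K2) / n%:R = 2 * K1 / n%:R + K2 / n%:R + K2 / n%:R by ring.
  by move: X0 Y0 XK YK K2n; clear; move=> *; rewrite ler_norml; apply/andP; lra.
have d1' u : decay 2 r M u <= 1.
  by rewrite /decay expR_le1 oppr_le0 !mulr_ge0 ?invr_ge0 ?(ltW r0).
have Kn : 0 <= (K1 + K2) / n%:R by rewrite divr_ge0 ?addr_ge0// ltW.
split.
  apply: (le_trans main).
  have h1 : \sum_(0 <= u < M.*2.+1) decay 2 r M u * \1_A (c + u%:Z) <= 4 * r.
    apply: (@le_trans _ _ (\sum_(0 <= u < M.*2.+1) decay 2 r M u)).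
      apply: ler_sum => u _; rewrite ler_piMr ?expR_ge0//.
    apply: (le_trans (sum_decay_le 2 r M (ltr0Sn R 1) r0)).
    by move: r1; clear; lra.
  have := ler_wpM2l Kn h1.
  have -> : (K1 + K2) / n%:R * (4 * r) = 4 * (K1 + K2) / r by rewrite -rE; field; rewrite gt_eqF.
  have : 2 * (K1 + K2) / n%:R <= 2 * (K1 + K2) / r.
    rewrite ler_wpM2l ?mulr_ge0 ?addr_ge0// -rE lef_pV2 ?posrE ?exprn_gt0//.
    by rewrite expr2 ler_peMl// ltW.
  have K0 : 0 <= (K1 + K2) / r by rewrite divr_ge0 ?addr_ge0// ltW.
  have -> : 10 * (K1 + K2) / r = 10 * ((K1 + K2) / r) by ring.
  have -> : 4 * (K1 + K2) / r = 4 * ((K1 + K2) / r) by ring.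
  have -> : 2 * (K1 + K2) / r = 2 * ((K1 + K2) / r) by ring.
  by move: K0; clear; move=> *; lra.
move=> a AE; apply: (le_trans main).
have h1 : \sum_(0 <= u < M.*2.+1) decay 2 r M u * \1_A (c + u%:Z) <= 1.
  apply: le_trans (sum_indic_set1_le1 c a M.*2.+1).
  rewrite AE; apply: ler_sum => u _; rewrite ler_piMl//.
have := ler_wpM2l Kn h1.
have -> : 10 * (K1 + K2) / n%:R = 10 * ((K1 + K2) / n%:R) by ring.
have -> : 2 * (K1 + K2) / n%:R = 2 * ((K1 + K2) / n%:R) by ring.
by move: Kn; clear; move=> *; lra.
Qed.

End Closeness.

(** * From the counting laws to the two distances *)

Section Conclusion.
Context {R : realType}.

Lemma bigO_nat (f g : nat -> R) (K B : R) :
  (forall n, B <= n%:R -> `|f n| <= K * `|g n|) ->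
  (f : nat -> R^o) =O_\oo (g : nat -> R^o).
Proof.
move=> H; apply/eqOP; near=> k; near=> n.
apply: (@le_trans _ _ (K * `|g n|)).
  by apply: H; near: n; exact: nbhs_infty_ger.
by rewrite ler_wpM2r//; near: k; apply: nbhs_pinfty_ge; rewrite num_real.
Unshelve. all: by end_near.
Qed.

Lemma dTV_le (mu nu : set R -> \bar R) (b : R) :
  (forall A : set int, `|fine (mu (intr @` A)) - fine (nu (intr @` A))| <= b) ->
  `|dTV mu nu| <= b.
Proof.
move=> H; rewrite /dTV; set E := [set _ | _ in _].
have ubE : ubound E b by move=> _ [A _ <-].
have neE : E !=set0 by exists `|fine (mu (intr @` set0)) - fine (nu (intr @` set0))|; exists set0.
rewrite ger0_norm; first exact: ge_sup.
apply: (@le_trans _ _ `|fine (mu (intr @` set0)) - fine (nu (intr @` set0))|) => //.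
by apply: ub_le_sup; [exists b|exists set0].
Qed.

Lemma dloc_le (mu nu : set R -> \bar R) (b : R) :
  (forall a : int, `|fine (mu [set a%:~R]) - fine (nu [set a%:~R])| <= b) ->
  `|dloc mu nu| <= b.
Proof.
move=> H; rewrite /dloc; set E := [set _ | _ in _].
have ubE : ubound E b by move=> _ [a _ <-].
have neE : E !=set0 by exists `|fine (mu [set 0%:~R]) - fine (nu [set 0%:~R])|; exists 0.
rewrite ger0_norm; first exact: ge_sup.
apply: (@le_trans _ _ `|fine (mu [set 0%:~R]) - fine (nu [set 0%:~R])|) => //.
by apply: ub_le_sup; [exists b|exists 0].
Qed.

(** [(1 - (-1) ^+ n) / 2] is the parity of [n], so adding it turns [n / 2] into its integer part. *)
Lemma half_spin_sum (n j : nat) :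
  (2 * j%:R - n%:R + (1 - (-1) ^+ n) / 2) / 2 = (j%:Z - (n./2)%:Z)%:~R :> R.
Proof.
have nE : n%:R = (odd n)%:R + 2 * (n./2)%:R :> R.
  by rewrite -{1}(odd_double_half n) natrD -mul2n natrM.
rewrite rmorphB/= -!pmulrn -signr_odd nE.
by case: (odd n); rewrite /= ?expr0 ?expr1; field.
Qed.

Lemma curie_weiss_half_law (beta h : R) (n : nat) d (T : measurableType d)
    (P : probability T R) (S : 'I_n -> {RV P >-> R}) (A : set int) :
  curie_weiss beta h S ->
  fine (pushforward P (fun w => (\sum_(i < n) S i w + (1 - (-1) ^+ n) / 2) / 2) (intr @` A)) =
  \sum_(0 <= j < n.+1) cw_pmf beta h n j * \1_A (j%:Z - (n./2)%:Z).
Proof.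
move=> cw; pose C := [set x : R | (intr @` A) ((x + (1 - (-1) ^+ n) / 2) / 2)].
have := curie_weiss_prob S cw C.
rewrite /pushforward /preimage /C /= => ->.
rewrite /=; apply: eq_bigr => j _; congr (_ * _).
rewrite !indicE; congr ((nat_of_bool _)%:R); apply/idP/idP => /set_mem /=.
  by rewrite half_spin_sum => -[a Aa /intr_inj <-]; exact: mem_set.
by move=> Aj; apply: mem_set; rewrite /= half_spin_sum; exists (j%:Z - (n./2)%:Z).
Qed.

(** The Poisson mean [sigma2 + gamma] equals [mu - s]: the translated law has mean exactly [mu], and
    the rounding only affects its variance, by less than 1. *)
Lemma translated_poissonE (mu sigma2 : R) (A : set int) :
  let s := Num.floor (mu - sigma2) in
  translated_poisson mu sigma2 (intr @` A) =
  poisson_prob (mu - s%:~R) 0%N [set i : nat | A (s + i%:Z)].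
Proof.
move=> s; rewrite /translated_poisson /pushforward -/s.
have -> : sigma2 + (mu - sigma2 - s%:~R) = mu - s%:~R by ring.
congr (poisson_prob _ _ _); apply/seteqP; split => i /=.
  move=> [a Aa]; rewrite pmulrn -rmorphD/= => /intr_inj <-//.
by move=> Ai; exists (s + i%:Z) => //; rewrite rmorphD/= -pmulrn.
Qed.

End Conclusion.

Theorem theorem2p14 (R : realType) (beta h : R)
  (hbh : (0 < h /\ 0 < beta) \/ (h = 0 /\ 0 < beta < 1))
  (d : nat -> measure_display) (Omega : forall n, measurableType (d n))
  (P : forall n, probability (Omega n) R)
  (S : forall n, 'I_n -> {RV P n >-> R})
  (hS : forall n, curie_weiss beta h (S n)) :
  let W := fun n (w : Omega n) => \sum_(i < n) S n i w in
  let sigma := fun n => Num.sqrt (fine 'V_(P n)[W n]) in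
  let Wt := fun n (w : Omega n) => (W n w + (1 - (-1) ^+ n) / 2) / 2 in
  let m := mean_spin beta h in
  let TP := fun n => translated_poisson (n%:R * m / 2)
    (n%:R * (1 - m ^+ 2) / (4 * (1 - beta + beta * m ^+ 2))) in
  [/\ (fun n => dTV (pushforward (P n) (Wt n)) (TP n) : R^o)
        =O_\oo (fun n => (sigma n)^-1 : R^o),
      (fun n => (sigma n)^-1%R : R^o) =O_\oo (fun n => n%:R `^ (- 2^-1) : R^o),
      (fun n => dloc (pushforward (P n) (Wt n)) (TP n) : R^o)
        =O_\oo (fun n => sigma n ^- 2 : R^o)
    & (fun n => (sigma n ^- 2)%R : R^o) =O_\oo (fun n => n%:R^-1 : R^o)].
Proof.
move=> W sigma Wt m TP.
have mag := mean_spinP beta h hbh; rewrite -/m in mag.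
have [K [B1 [K0 close]]] := cw_poisson_close beta h m mag.
have [c [V [B2 [c0 V0 var]]]] := cw_variance_bounds beta h m mag.
have [b0 /andP[m0 m1] _ bm _] := mag.
pose B := 1 + `|B1| + `|B2|.
have Bn (n : nat) : B <= n%:R -> [/\ B1 <= n%:R, B2 <= n%:R & 1 <= n%:R :> R].
  rewrite /B; have := ler_norm B1; have := ler_norm B2.
  have := normr_ge0 B1; have := normr_ge0 B2; clear.
  by move: (`|B1|) (`|B2|) => *; split; lra.
have s2 (n : nat) : B <= n%:R -> c * n%:R <= sigma n ^+ 2 <= V * n%:R.
  move=> /Bn[_ nB2 _]; rewrite /sigma.
  rewrite (curie_weiss_variance (S n) (hS n)).
  rewrite sqr_sqrtr; first exact: var.
  by apply: sumr_ge0 => j _; rewrite mulr_ge0 ?cw_pmf_ge0 ?sqr_ge0.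
have s0 (n : nat) : B <= n%:R -> 0 < sigma n.
  move=> nB; have [_ _ n1] := Bn n nB.
  have n0 : 0 < n%:R :> R by exact: lt_le_trans n1.
  have /andP[cs _] := s2 n nB.
  have : 0 < sigma n ^+ 2 by rewrite (lt_le_trans _ cs)// mulr_gt0.
  by rewrite exprn_even_gt0//= lt0r sqrtr_ge0 andbT.
have tv (n : nat) : B <= n%:R -> forall A : set int,
    let D := `|fine (pushforward (P n) (Wt n) (intr @` A)) - fine (TP n (intr @` A))| in
    D <= K / @Num.sqrt R n%:R /\ (forall a, A = [set a] -> D <= K / n%:R).
  move=> nB A; have [nB1 _ _] := Bn n nB.
  rewrite /TP translated_poissonE /Wt /W (curie_weiss_half_law beta h)//.
  set s := Num.floor _.
  have /andP[f1 f2] := floor_itv (n%:R * m / 2 -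
    n%:R * (1 - m ^+ 2) / (4 * (1 - beta + beta * m ^+ 2))).
  rewrite -/s intrD in f1 f2.
  (* Identifies the prescribed variance with [n / kappa], through [1 - beta + beta * m ^+ 2 = 1 -
     beta * (1 - m ^+ 2)]. *)
  have kE : n%:R * (1 - m ^+ 2) / (4 * (1 - beta + beta * m ^+ 2)) = n%:R / cw_kappa beta m.
    have q : 1 - m ^+ 2 != 0 by rewrite gt_eqF// subr_gt0 expr_lt1.
    have q' : 1 - beta * (1 - m ^+ 2) != 0 by rewrite gt_eqF// subr_gt0.
    rewrite /cw_kappa; have -> : 1 - beta + beta * m ^+ 2 = 1 - beta * (1 - m ^+ 2) by ring.
    by field; rewrite mulNr q q'.
  rewrite kE in f1 f2.
  have lN : `|n%:R * m / 2 - s%:~R - n%:R / cw_kappa beta m| <= 1.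
    rewrite ler_norml; move: f1 f2; clear; rewrite -[1%:~R]/(1 : R).
    by move: (s%:~R) (_ / cw_kappa _ _) => x y *; apply/andP; lra.
  by have [_ H] := close n s _ nB1 lN (subrK _ _); exact: H.
split.
- apply: (bigO_nat _ _ (K * Num.sqrt V) B) => n nB.
  have [_ _ n1] := Bn n nB; have n0 : 0 < n%:R :> R by exact: lt_le_trans n1.
  have sn := s0 n nB; have r0 : 0 < @Num.sqrt R n%:R by rewrite sqrtr_gt0.
  apply: (@le_trans _ _ (K / @Num.sqrt R n%:R)).
    by apply: dTV_le => A; have [] := tv n nB A.
  rewrite normfV (gtr0_norm sn) -mulrA ler_wpM2l//.
  rewrite ler_pdivlMr// [leLHS]mulrC ler_pdivrMr//.
  have -> : Num.sqrt V * @Num.sqrt R n%:R = Num.sqrt (V * n%:R) by rewrite sqrtrM// ltW.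
  rewrite -(ger0_norm (ltW sn)) -sqrtr_sqr ler_wsqrtr//.
  by have /andP[] := s2 n nB.
- apply: (bigO_nat _ _ (Num.sqrt c)^-1 B) => n nB.
  have [_ _ n1] := Bn n nB; have n0 : 0 < n%:R :> R by exact: lt_le_trans n1.
  have sn := s0 n nB; have r0 : 0 < @Num.sqrt R n%:R by rewrite sqrtr_gt0.
  rewrite powRN powR12_sqrt// !normfV (gtr0_norm sn) (gtr0_norm r0) -invfM.
  rewrite lef_pV2 ?posrE//; last by rewrite mulr_gt0 ?sqrtr_gt0.
  have -> : Num.sqrt c * @Num.sqrt R n%:R = Num.sqrt (c * n%:R) by rewrite sqrtrM// ltW.
  rewrite -(ger0_norm (ltW sn)) -sqrtr_sqr ler_wsqrtr//.
  by have /andP[] := s2 n nB.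
- apply: (bigO_nat _ _ (K * V) B) => n nB.
  have [_ _ n1] := Bn n nB; have n0 : 0 < n%:R :> R by exact: lt_le_trans n1.
  have sn := s0 n nB; have sn2 : 0 < sigma n ^+ 2 by rewrite exprn_gt0.
  apply: (@le_trans _ _ (K / n%:R)).
    apply: dloc_le => a; have [_] := tv n nB [set a].
    by rewrite image_set1; apply.
  rewrite normfV (gtr0_norm sn2) -mulrA ler_wpM2l//.
  rewrite ler_pdivlMr// [leLHS]mulrC ler_pdivrMr//.
  by have /andP[] := s2 n nB.
- apply: (bigO_nat _ _ c^-1 B) => n nB.
  have [_ _ n1] := Bn n nB; have n0 : 0 < n%:R :> R by exact: lt_le_trans n1.
  have sn := s0 n nB; have sn2 : 0 < sigma n ^+ 2 by rewrite exprn_gt0.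
  rewrite !normfV (gtr0_norm sn2) (gtr0_norm n0) -invfM.
  rewrite lef_pV2 ?posrE ?mulr_gt0//.
  by have /andP[] := s2 n nB.
Qed.
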